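(* Let $B=\bigoplus_{n\geq 0}B_n$ be a reduced standard graded algebra over a field $k$ and let $A=\bigoplus_{n\geq 0}A_n$ be a standard graded $k$-subalgebra of $B$. Then $$\varepsilon(A\mid B)=\lim_{n\to\infty}\frac{(\dim B-1)!}{n^{\dim B-1}}\, l_k\left(B_n/A_n\right)$$ exists as a finite limit.
   Context: A standard graded $k$-algebra is a graded $k$-algebra $T=\bigoplus_{n\geq 0}T_n$ with $T_0=k$ which is generated over $k$ by finitely many homogeneous elements of $T_1$. A standard graded $k$-subalgebra $A$ of $B$ is a graded subalgebra ($A_n\subset B_n$ for all $n$) which is itself a standard graded $k$-algebra. $l_k$ denotes length as a $k$-module, i.e. $k$-vector space dimension, and $\dim$ is Krull dimension. For a graded inclusion $A\subset B$ of standard graded algebras over a Noetherian local ring $R$ with maximal ideal $m_R$, the relative $\varepsilon$-multiplicity is $\varepsilon(A\mid B):=\limsup_{n}\frac{(\dim B-1)!}{n^{\dim B-1}}\,l_R\big(H^0_{m_R}(B_n/A_n)\big)$; here $R=k$ and $m_R=0$, so $H^0_{m_R}(B_n/A_n)=B_n/A_n$. *)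

(* Defs.v *)
From HB Require Import structures.
From mathcomp Require Import all_boot all_order all_algebra.
From mathcomp Require Import all_classical all_reals all_analysis.

Set Implicit Arguments.
Unset Strict Implicit.
Unset Printing Implicit Defensive.

Import Order.TTheory GRing.Theory Num.Theory.

Local Open Scope classical_set_scope.
Local Open Scope ring_scope.

(* Subsets of an algebra are {pred C}; under the classical axioms of boolp
   these are arbitrary subsets, not only decidable ones. *)

(* The subset T of C, with homogeneous components T_n, is a standard graded
   k-algebra for the operations of C.  The algebra C itself is the case
   T = predT. *)
Record standard_graded (k : fieldType) (C : comAlgType k)
    (T : {pred C}) (T_ : nat -> {pred C}) : Prop := StandardGraded {
  sg_subalg : subalg_closed T;
  sg_sub : forall n, {subset T_ n <= T};
  sg_submod : forall n, submod_closed (T_ n);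
  sg_mul : forall m n x y, x \in T_ m -> y \in T_ n -> x * y \in T_ (m + n)%N;
  sg_span : forall x, x \in T ->
    exists (N : nat) (c : nat -> C),
      (forall n, c n \in T_ n) /\ x = \sum_(n < N) c n;
  sg_direct : forall (N : nat) (c : nat -> C),
    (forall n, c n \in T_ n) -> \sum_(n < N) c n = 0 ->
    forall n, (n < N)%N -> c n = 0;
  (* T_0 = k, with k embedded in the nonzero ring C by a |-> a%:A *)
  sg_base : forall x, x \in T_ 0%N <-> exists a : k, x = a%:A;
  sg_gen : exists s : seq C, {subset s <= T_ 1%N} /\
    forall S : {pred C}, subalg_closed S -> {subset s <= S} -> {subset T <= S}
}.

Definition reduced_ring (C : comNzRingType) : Prop :=
  forall (x : C) (n : nat), x ^+ n = 0 -> x = 0.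

(* idealr_closed includes properness. *)
Definition prime_ideal (C : comNzRingType) (P : {pred C}) : Prop :=
  idealr_closed P /\ prime_idealr_closed P.

(* P 0 < P 1 < ... < P d; the values P i for i > d are irrelevant. *)
Definition prime_chain (C : comNzRingType) (d : nat)
    (P : nat -> {pred C}) : Prop :=
  (forall i, (i <= d)%N -> prime_ideal (P i)) /\
  (forall i, (i < d)%N ->
     {subset P i <= P i.+1} /\ exists2 x, x \in P i.+1 & x \notin P i).

(* The maximal length of a chain of primes; junk value 0 when the lengths are
   unbounded, which does not happen for a finitely generated k-algebra. *)
Definition krull_dim (C : comNzRingType) : nat :=
  xget 0%N [set d | (exists P : nat -> {pred C}, prime_chain d P) /\
                    (forall e (P : nat -> {pred C}),
                       prime_chain e P -> (e <= d)%N)].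

(* The classes of v_0, ..., v_(d-1) form a basis of V / W. *)
Definition quot_basis (k : fieldType) (C : lmodType k) (V W : {pred C})
    (d : nat) (v : 'I_d -> C) : Prop :=
  [/\ forall i, v i \in V,
      forall c : 'I_d -> k, \sum_i c i *: v i \in W -> forall i, c i = 0
    & forall x, x \in V -> exists c : 'I_d -> k, x - \sum_i c i *: v i \in W].

(* dim_k (V / W) for subspaces W <= V: the set below is a singleton if V / W
   is finite-dimensional, and otherwise it is empty and the value is +oo. *)
Definition quot_dim (R : realType) (k : fieldType) (C : lmodType k)
    (V W : {pred C}) : \bar R :=
  ereal_inf [set (d%:R)%:E | d in
    [set d : nat | exists v : 'I_d -> C, quot_basis V W v]].

(* (dim B - 1)! / n ^ (dim B - 1) * l_k (B_n / A_n).  The truncated predecessor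
   only matters when dim B = 0; a reduced standard graded algebra B is then
   equal to k, so that the lengths vanish. *)
Definition normalized_length (R : realType) (k : fieldType) (B : comAlgType k)
    (A_ B_ : nat -> {pred B}) (n : nat) : \bar R :=
  let e := (krull_dim B).-1 in
  ((e`!%:R / n%:R ^+ e)%:E * quot_dim R (B_ n) (A_ n))%E.

(* The relative epsilon-multiplicity over a local ring (R, m) is built from
   the lengths of H^0_m (B_n / A_n).  Over the field k, m = 0 and H^0_m is the
   whole of B_n / A_n. *)
Definition epsilon_mult (R : realType) (k : fieldType) (B : comAlgType k)
    (A_ B_ : nat -> {pred B}) : \bar R :=
  limn_esup (normalized_length R A_ B_).

(* Main.v *)
(** The length of B_n/A_n is H_B(n) - H_A(n), the difference of two Hilbert
    functions, with 0 <= H_A <= H_B.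

    Hilbert functions are eventually polynomial: for a homogeneous ideal I of
    an algebra generated by m elements of degree 1, the monomials that are not
    congruent modulo I to a combination of lexicographically smaller ones form
    a basis of the quotient, and the exponents of the other monomials form an
    upward closed subset of N^m.  Slicing such a subset along the first
    exponent, where the slices stabilize by Dickson's lemma, shows that the
    number of points of degree n outside of it is eventually polynomial.

    It remains to see that H_B(n) = O(n^e) with e = dim B - 1.  If the Hilbert
    function of B/I is not O(n^j), enlarge I to a homogeneous Q maximal with
    that property.  The identity H_(B/Q)(n) = H_(B/(Q+xB))(n) +
    H_(B/(Q:x))(n-deg x) shows that Q is prime, and that for x of degree 1
    outside Q the Hilbert function of B/(Q+xB) is not O(n^(j-1)).  Iterating,
    and ending with the irrelevant ideal, yields a chain of primes of length
    j + 2.  Finally dim B is attained: elements y_i of P_(i+1) outside P_i, for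
    a chain of primes P_i, are algebraically independent, so counting monomials
    bounds the length of chains by m. *)

Require Import Defs.
From mathcomp Require Import all_boot all_order all_algebra.
From mathcomp Require Import all_classical all_reals all_analysis.
From mathcomp Require Import zify ring.

Set Implicit Arguments.
Unset Strict Implicit.
Unset Printing Implicit Defensive.

Import Order.TTheory GRing.Theory Num.Theory.
Import numFieldNormedType.Exports.

Local Open Scope classical_set_scope.
Local Open Scope ring_scope.

(** * Dimensions of quotients of subspaces *)

Section SubspaceDimension.
Variables (k : fieldType) (C : lmodType k).
Implicit Types (U V W : {pred C}) (x y : C) (vs : seq C) (d e : nat).

Lemma submodD W x y : submod_closed W -> x \in W -> y \in W -> x + y \in W.
Proof. by case=> _ lW xW yW; rewrite -[x]scale1r lW. Qed.

Lemma submodZ W (a : k) x : submod_closed W -> x \in W -> a *: x \in W.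
Proof. by case=> W0 lW xW; rewrite -[_ *: _]addr0 lW. Qed.

Lemma submodB W x y : submod_closed W -> x \in W -> y \in W -> x - y \in W.
Proof. by move=> sW xW yW; apply: submodD => //; rewrite -scaleN1r submodZ. Qed.

Lemma submod_sum W (I : Type) (r : seq I) (P : pred I) (F : I -> C) :
  submod_closed W -> (forall i, P i -> F i \in W) ->
  \sum_(i <- r | P i) F i \in W.
Proof.
move=> sW FW; apply: (big_ind (fun x => x \in W)) => //; first by case: sW.
by move=> x y; apply: submodD.
Qed.

Lemma submodBr W x y : submod_closed W -> x - y \in W -> y \in W -> x \in W.
Proof. by move=> sW xyW yW; rewrite -(subrK y x) submodD. Qed.

Lemma submod_pred1_0 : submod_closed (pred1 (0 : C)).
Proof.
split; first by rewrite inE.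
by move=> a u v; rewrite !inE => /eqP -> /eqP ->; rewrite scaler0 addr0.
Qed.

Definition addline W (v : C) : {pred C} :=
  [pred x | `[< exists a : k, x - a *: v \in W >]].

Lemma in_addline W v x :
  (x \in addline W v) <-> exists a : k, x - a *: v \in W.
Proof. by rewrite inE. Qed.

Lemma submod_addline W v : submod_closed W -> submod_closed (addline W v).
Proof.
move=> sW; split.
  by apply/in_addline; exists 0; rewrite scale0r subr0; case: sW.
move=> a x y /in_addline[b xb] /in_addline[c yc].
apply/in_addline; exists (a * b + c).
have -> : a *: x + y - (a * b + c) *: v =
          a *: (x - b *: v) + (y - c *: v).
  by rewrite scalerDl scalerBr scalerA opprD addrACA.
by apply: submodD => //; apply: submodZ.
Qed.

Lemma sub_addline W v : {subset W <= addline W v}.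
Proof. by move=> x xW; apply/in_addline; exists 0; rewrite scale0r subr0. Qed.

Lemma mem_addline W v : submod_closed W -> v \in addline W v.
Proof.
by move=> [W0 _]; apply/in_addline; exists 1; rewrite scale1r subrr.
Qed.

Lemma addline_min U W v : submod_closed U -> {subset W <= U} -> v \in U ->
  {subset addline W v <= U}.
Proof.
move=> sU WU vU x /in_addline[a /WU xaU].
exact: submodBr sU xaU (submodZ _ sU vU).
Qed.

Fixpoint addspan W vs : {pred C} :=
  if vs is v :: vs' then addspan (addline W v) vs' else W.

Lemma submod_addspan W vs : submod_closed W -> submod_closed (addspan W vs).
Proof.
by elim: vs W => [|v vs IH] W //= sW; apply: IH; apply: submod_addline.
Qed.

Lemma sub_addspan W vs : {subset W <= addspan W vs}.
Proof.
elim: vs W => [|v vs IH] W x xW //=; apply: IH; exact: sub_addline.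
Qed.

Lemma mem_addspan W vs v : submod_closed W -> v \in vs -> v \in addspan W vs.
Proof.
elim: vs W => [|u vs IH] W sW //=; rewrite inE => /orP[/eqP ->|vvs].
  exact/sub_addspan/mem_addline.
exact/IH/vvs/submod_addline.
Qed.

Lemma addspan_min U W vs : submod_closed U -> {subset W <= U} ->
  {subset vs <= U} -> {subset addspan W vs <= U}.
Proof.
move=> sU; elim: vs W => [|v vs IH] W //= WU vsU.
apply: IH => [|x xvs]; last by apply: vsU; rewrite inE xvs orbT.
by apply: addline_min => //; apply: vsU; rewrite mem_head.
Qed.

Lemma addspan_sub W W' vs vs' : submod_closed W' -> {subset W <= W'} ->
  {subset vs <= vs'} -> {subset addspan W vs <= addspan W' vs'}.
Proof.
move=> sW' WW' vv'; apply: addspan_min.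
- exact: submod_addspan.
- by move=> x /WW' xW; apply: sub_addspan.
- by move=> x /vv' xv; apply: mem_addspan.
Qed.

Lemma in_addspanP W vs x : x \in addspan W vs ->
  exists c : 'I_(size vs) -> k, x - \sum_i c i *: vs`_i \in W.
Proof.
elim: vs W => [|v vs IH] W /=.
  by move=> xW; exists (fun=> 0); rewrite big_ord0 subr0.
move=> /IH[c /in_addline[a xW]].
exists (fun i => oapp c a (unlift ord0 i)).
rewrite big_ord_recl unlift_none /= opprD addrA addrAC.
by under eq_bigr => i _ do rewrite liftK /=.
Qed.

(** A relation rather than a function: it asserts finite dimension as well, and [quot_dimE] converts
    it to [quot_dim]. *)
Definition qdim V W d := exists v : 'I_d -> C, quot_basis V W v.

(** Steinitz bound: with [d > size vs] the coefficient matrix of the [v i] has a nonzero left kernel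
    vector, which is a relation between the [v i] modulo [W]. *)
Lemma indep_le_size W vs d (v : 'I_d -> C) : submod_closed W ->
  (forall i, v i \in addspan W vs) ->
  (forall c : 'I_d -> k, \sum_i c i *: v i \in W -> forall i, c i = 0) ->
  (d <= size vs)%N.
Proof.
move=> sW vspan vfree.
have /choice[M hM] : forall i, exists c : 'I_(size vs) -> k,
  v i - \sum_j c j *: vs`_j \in W by move=> i; apply: in_addspanP.
pose A : 'M[k]_(d, size vs) := \matrix_(i, j) M i j.
rewrite leqNgt; apply/negP => lt.
have : kermx A != 0.
  rewrite -mxrank_eq0 mxrank_ker -lt0n subn_gt0.
  exact: leq_ltn_trans (rank_leq_col A) lt.
case/rowV0Pn => u /sub_kermxP uA u0.
case/negP: u0; apply/eqP/rowP => i; rewrite [RHS]mxE.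
apply: (vfree (fun i => u 0 i)).
have -> : \sum_i u 0 i *: v i =
    \sum_i u 0 i *: (v i - \sum_j M i j *: vs`_j).
  under [RHS]eq_bigr do rewrite scalerBr scaler_sumr.
  rewrite sumrB exchange_big /= [X in _ - X]big1 ?subr0 // => j _.
  under eq_bigr do rewrite scalerA.
  rewrite -scaler_suml.
  have := congr1 (fun B : 'rV_(size vs) => B 0 j) uA.
  rewrite !mxE; under eq_bigr do rewrite mxE.
  by move=> ->; rewrite scale0r.
by apply: submod_sum => // i' _; apply: submodZ.
Qed.

Lemma sum_span_mem W d (v : 'I_d -> C) (c : 'I_d -> k) : submod_closed W ->
  \sum_i c i *: v i \in addspan W (codom v).
Proof.
move=> sW; apply: submod_sum => [|i _]; first exact: submod_addspan.
apply: submodZ; first exact: submod_addspan.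
by apply: mem_addspan => //; apply: codom_f.
Qed.

Lemma qdim_le V V' W W' d e : submod_closed W' -> {subset V <= V'} ->
  {subset W <= W'} -> qdim V W' d -> qdim V' W e -> (d <= e)%N.
Proof.
move=> sW' VV' WW' [v [vV vfree _]] [w [_ _ wspan]].
have -> : e = size (codom w) by rewrite size_codom card_ord.
apply: (indep_le_size sW' (v := v)) => // i.
have [c hc] := wspan _ (VV' _ (vV i)).
apply: submodBr (sum_span_mem w c sW'); first exact: submod_addspan.
exact/sub_addspan/WW'.
Qed.

Lemma qdim_uniq V W d e : submod_closed W -> qdim V W d -> qdim V W e -> d = e.
Proof.
by move=> sW hd he; apply/eqP; rewrite eqn_leq !(@qdim_le V V W W).
Qed.

Lemma qdim_ext V V' W W' d : V =i V' -> W =i W' -> qdim V W d -> qdim V' W' d.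
Proof.
move=> eV eW [v [h1 h2 h3]]; exists v; split.
- by move=> i; rewrite -eV.
- by move=> c; rewrite -eW; apply: h2.
- by move=> x; rewrite -eV => /h3[c hc]; exists c; rewrite -eW.
Qed.

Lemma qdim_refl W : submod_closed W -> qdim W W 0.
Proof.
move=> sW; exists (fun=> 0); split; [by case|by move=> c _; case|].
by move=> x xW; exists (fun=> 0); rewrite big_ord0 subr0.
Qed.

Lemma qdim_addline W v : submod_closed W ->
  qdim (addline W v) W (v \notin W).
Proof.
move=> sW; case: (boolP (v \in W)) => vW /=.
  apply: (@qdim_ext W _ W) => //; last exact: qdim_refl.
  move=> x; apply/idP/idP; first exact: sub_addline.
  by apply: addline_min.
exists (fun=> v); split.
- by move=> _; apply: mem_addline.
- move=> c; rewrite big_ord1 => cvW i; rewrite (ord1 i).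
  apply/eqP; apply: contraNT vW => c0.
  by rewrite -(scalerK c0 v); apply: submodZ.
- move=> x /in_addline[a xa]; exists (fun=> a); by rewrite big_ord1.
Qed.

Lemma qdim_add U V W d e : submod_closed W -> submod_closed V ->
  submod_closed U -> {subset W <= V} -> {subset V <= U} ->
  qdim V W d -> qdim U V e -> qdim U W (d + e)%N.
Proof.
move=> sW sV sU WV VU [v [vV vf vs]] [u [uU uf us]].
pose w i := match fintype.split i with inl i => v i | inr j => u j end.
have wl i : w (lshift e i) = v i by rewrite /w (unsplitK (inl _ i)).
have wr i : w (rshift d i) = u i by rewrite /w (unsplitK (inr _ i)).
have sumw c : \sum_i c i *: w i =
    \sum_i c (lshift e i) *: v i + \sum_i c (rshift d i) *: u i.
  rewrite big_split_ord /=; congr (_ + _); apply: eq_bigr => i _.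
    by rewrite wl.
  by rewrite wr.
have sumv c : \sum_i c i *: v i \in V.
  by apply: submod_sum => // i _; apply: submodZ.
exists w; split.
- by move=> i; rewrite /w; case: (fintype.split i) => j //; apply: VU.
- move=> c; rewrite sumw => cW.
  (* Modulo [V] only the combination of the [u j] survives, so its coefficients vanish first. *)
  have cu : forall i, c (rshift d i) = 0.
    apply: (uf (fun i => c (rshift d i))).
    apply: submodBr sV _ (sumv (fun i => - c (lshift e i))).
    by under [X in _ - X]eq_bigr do rewrite scaleNr;
       rewrite sumrN opprK addrC; apply: WV.
  have cv : forall i, c (lshift e i) = 0.
    apply: (vf (fun i => c (lshift e i))); move: cW.
    by rewrite [X in _ + X]big1 ?addr0 // => i _; rewrite cu scale0r.
  by move=> i; rewrite -(fintype.splitK i); case: (fintype.split i) => j /=.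
- move=> x /us[c xc].
  have [b hb] := vs _ xc.
  exists (fun i => match fintype.split i with inl i => b i | inr j => c j end).
  rewrite sumw opprD addrA addrAC.
  under eq_bigr do rewrite (unsplitK (inr _ _)).
  by under [X in _ - X]eq_bigr do rewrite (unsplitK (inl _ _)).
Qed.

(** Greedy choice: the vectors that are new modulo their predecessors form a basis of [addspan W vs]
    modulo [W]. *)
Fixpoint nindep W vs : nat :=
  if vs is v :: vs' then ((v \notin W) + nindep (addline W v) vs')%N else 0%N.

Lemma qdim_addspan W vs : submod_closed W ->
  qdim (addspan W vs) W (nindep W vs).
Proof.
elim: vs W => [|v vs IH] W sW /=; first exact: qdim_refl.
have sWv := submod_addline v sW.
apply: (@qdim_add _ (addline W v)) => //.
- exact: submod_addspan.
- exact: sub_addline.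
- exact: sub_addspan.
- exact: qdim_addline.
- exact: IH.
Qed.

(** A vector [z] of [W] outside [W'] would make the codimension of [W' + kz] in [V] equal to
    [d - 1], although this space lies in [W], of codimension [d]. *)
Lemma qdim_eq_sub V W W' d :
  submod_closed V -> submod_closed W' -> submod_closed W ->
  {subset W' <= W} -> {subset W <= V} ->
  qdim V W' d -> qdim V W d -> {subset W <= W'}.
Proof.
move=> sV sW' sW W'W WV hd' hd z zW; apply: contraT => zW'.
have [v [vV _ vspan]] := hd'.
have sZ := submod_addline z sW'.
have ZW : {subset addline W' z <= W} by apply: addline_min.
pose e := nindep (addline W' z) (codom v).
have he : qdim V (addline W' z) e.
  apply: qdim_ext (qdim_addspan (codom v) sZ) => // x; apply/idP/idP.
    apply: addspan_min => // [y /ZW /WV //|_ /codomP[i ->] //].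
  move=> /vspan[c xc]; apply: submodBr (sum_span_mem v c sZ).
    exact: submod_addspan.
  exact/sub_addspan/sub_addline.
have d1e : d = (1 + e)%N.
  apply: (qdim_uniq sW' hd').
  apply: (@qdim_add V (addline W' z)) => //.
  - exact: sub_addline.
  - by move=> y /ZW /WV.
  - by have := qdim_addline z sW'; rewrite zW'.
by have := qdim_le sW (fun x (xV : x \in V) => xV) ZW hd he; rewrite d1e ltnn.
Qed.

Lemma quot_dimE (R : realType) V W d : submod_closed W -> qdim V W d ->
  quot_dim R V W = (d%:R)%:E.
Proof.
move=> sW hd; rewrite /quot_dim.
suff -> : [set d0 | exists v : 'I_d0 -> C, quot_basis V W v] = [set d].
  by rewrite image_set1 ereal_inf1.
apply/seteqP; split => [e he|_ ->] //=; exact: (@qdim_uniq V W).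
Qed.

End SubspaceDimension.

(** The hypotheses say that [f] induces an isomorphism from [V / W] to [V' / W']; it serves for
    multiplication by a homogeneous element. *)
Lemma qdim_map (k : fieldType) (C D : lmodType k) (f : {linear C -> D})
    (V W : {pred C}) (V' W' : {pred D}) d :
  submod_closed W' ->
  (forall x, x \in V -> f x \in V') ->
  (forall x, x \in V -> (f x \in W') = (x \in W)) ->
  (forall y, y \in V' -> exists2 x, x \in V & y - f x \in W') ->
  submod_closed V -> qdim V W d -> qdim V' W' d.
Proof.
move=> sW' fV fW fs sV [v [h1 h2 h3]].
have fsum c : f (\sum_i c i *: v i) = \sum_i c i *: f (v i).
  by rewrite linear_sum; apply: eq_bigr => i _; rewrite linearZ.
have vsum c : \sum_i c i *: v i \in V.
  by apply: submod_sum => // i _; apply: submodZ.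
exists (f \o v); split => [i|c|y yV'] /=; first exact: fV.
  by rewrite -fsum fW //; apply: h2.
have [x xV yx] := fs _ yV'; have [c hc] := h3 _ xV.
exists c; rewrite -fsum -(subrK (f x) y) -addrA -linearB.
by apply: submodD => //; rewrite fW //; apply: submodB.
Qed.

(** * Eventually polynomial functions and upward closed sets of exponents *)

Section EventuallyPolynomial.
Variable R : realFieldType.
Implicit Types (f g : nat -> nat) (p q : {poly R}).

Definition evpoly f : Prop :=
  exists p N, forall n, (N <= n)%N -> (f n)%:R = p.[n%:R] :> R.

Lemma evpoly_eq f g N : (forall n, (N <= n)%N -> f n = g n) ->
  evpoly f -> evpoly g.
Proof.
move=> fg [p [M hp]]; exists p, (maxn N M) => n.
by rewrite geq_max => /andP[Nn Mn]; rewrite -fg // hp.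
Qed.

Lemma evpoly0 : evpoly (fun=> 0%N).
Proof. by exists 0, 0%N => n _; rewrite horner0. Qed.

Lemma evpolyD f g : evpoly f -> evpoly g -> evpoly (fun n => f n + g n)%N.
Proof.
move=> [p [N hp]] [q [M hq]]; exists (p + q), (maxn N M) => n.
by rewrite geq_max => /andP[Nn Mn]; rewrite natrD hornerD hp // hq.
Qed.

Lemma evpoly_sum (I : Type) (r : seq I) (F : I -> nat -> nat) :
  (forall i, evpoly (F i)) -> evpoly (fun n => \sum_(i <- r) F i n)%N.
Proof.
move=> hF; elim: r => [|i r IH].
  by apply: (@evpoly_eq (fun=> 0%N) _ 0%N) evpoly0 => n _; rewrite big_nil.
apply: (@evpoly_eq (fun n => F i n + \sum_(i <- r) F i n)%N _ 0%N).
  by move=> n _; rewrite big_cons.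
exact: evpolyD.
Qed.

Lemma evpoly_shift a f : evpoly f -> evpoly (fun n => f (n - a)%N).
Proof.
move=> [p [N hp]]; exists (p \Po ('X - a%:R%:P)), (N + a)%N => n Nn.
rewrite horner_comp !hornerE -natrB ?hp //; lia.
Qed.

(** The polynomial [q] is a discrete antiderivative of [h]. *)
Let has_sum (h : nat -> R) : Prop :=
  exists q, forall n, q.[n.+1%:R] - q.[n%:R] = h n.

Let has_sumZ c h : has_sum h -> has_sum (fun n => c * h n).
Proof.
move=> [q hq]; exists (c *: q) => n; by rewrite !hornerZ -mulrBr hq.
Qed.

Let has_sum_sum m (F : 'I_m -> nat -> R) :
  (forall i, has_sum (F i)) -> has_sum (fun n => \sum_i F i n).
Proof.
move=> /choice[q hq]; exists (\sum_i q i) => n.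
by rewrite !horner_sum -sumrB; apply: eq_bigr => i _; rewrite hq.
Qed.

(* (n + 1)^(d + 1) - n^(d + 1) = (d + 1) n^d + lower powers of n. *)
Let has_sum_exp d : has_sum (fun n => n%:R ^+ d).
Proof.
elim/ltn_ind: d => d IH.
have [q hq] : has_sum (fun n => \sum_(i < d) 'C(d.+1, i)%:R * n%:R ^+ i).
  by apply: has_sum_sum => i; apply/has_sumZ/IH.
exists (d.+1%:R^-1 *: ('X^(d.+1) - q)) => n.
rewrite !hornerE -mulrBr.
have -> : n.+1%:R ^+ d.+1 - q.[n.+1%:R] - (n%:R ^+ d.+1 - q.[n%:R]) =
    n.+1%:R ^+ d.+1 - n%:R ^+ d.+1 - (q.[n.+1%:R] - q.[n%:R]) by ring.
rewrite hq -[n.+1]addn1 natrD (addrC n%:R) exprDn !big_ord_recr /=.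
rewrite !subnn !subSnn.
under eq_bigr do rewrite expr1n mul1r.
rewrite !expr1n !mul1r binn mulr1n.
have -> : \sum_(i < d) 'C(d.+1, i)%:R * n%:R ^+ i =
          \sum_(i < d) n%:R ^+ i *+ 'C(d.+1, i) :> R.
  by apply: eq_bigr => i _; rewrite mulr_natl.
rewrite binSn -[_ *+ d.+1]mulr_natl.
set S := \sum_(i < d) _; set x := n%:R ^+ d; set y := n%:R ^+ d.+1.
have d0 : d.+1%:R != 0 :> R by rewrite pnatr_eq0.
by field.
Qed.

Let has_sum_horner p : has_sum (fun n => p.[n%:R]).
Proof.
have [q hq] : has_sum (fun n => \sum_(i < size p) p`_i * n%:R ^+ i).
  by apply: has_sum_sum => i; apply/has_sumZ/has_sum_exp.
by exists q => n; rewrite hq -horner_coef.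
Qed.

(** Beyond [N] the sum telescopes to values of the antiderivative [q]; the constant added to [q]
    accounts for the terms below [N]. *)
Lemma evpoly_psum f : evpoly f -> evpoly (fun n => \sum_(j < n) f j)%N.
Proof.
move=> [p [N hp]]; have [q hq] := has_sum_horner p.
exists (q + ((\sum_(j < N) f j)%N%:R - q.[N%:R])%:P), N => n.
move=> /subnK <-; elim: (n - N)%N => [|m IH].
  by rewrite add0n hornerD hornerC addrC subrK.
rewrite addSn big_ord_recr natrD IH hp ?leq_addl //= -hq.
by rewrite !hornerD !hornerC addrC addrA subrK.
Qed.

End EventuallyPolynomial.

(** * Exponent vectors, the lexicographic order and Dickson's lemma *)

Fixpoint mons (m n : nat) : seq (seq nat) :=
  if m is m'.+1 then
    flatten [seq [seq a :: b | b <- mons m' (n - a)] | a <- iota 0 n.+1]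
  else if n is 0 then [:: [::]] else [::].

Lemma monsS m n : mons m.+1 n =
  flatten [seq [seq a :: b | b <- mons m (n - a)] | a <- iota 0 n.+1].
Proof. by []. Qed.

Lemma mem_mons m n al : (al \in mons m n) = (size al == m) && (sumn al == n).
Proof.
elim: m n al => [|m IH] n al; first by case: n al => [|n] [|a al].
rewrite monsS; apply/flatten_mapP/idP => [[a]|].
  rewrite mem_iota => an /mapP[b]; rewrite IH => /andP[/eqP sb /eqP nb] -> /=.
  rewrite sb eqxx nb; lia.
case: al => [|a al] // /andP[/eqP[sa] /eqP <-].
rewrite -[sumn _]/(a + sumn al)%N.
exists a; first by rewrite mem_iota; lia.
by apply: map_f; rewrite IH sa addKn !eqxx.
Qed.

Lemma count_monsS (p : pred (seq nat)) m n :
  count p (mons m.+1 n) =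
  (\sum_(a < n.+1) count (fun b => p (nat_of_ord a :: b)) (mons m (n - a)))%N.
Proof.
rewrite monsS count_flatten sumnE -map_comp big_map -(big_mkord xpredT
  (fun a => count (fun b => p (a :: b)) (mons m (n - a)))).
by rewrite /index_iota subn0; apply: eq_bigr => a _ /=; rewrite count_map.
Qed.

Fixpoint lex (al be : seq nat) : bool :=
  match al, be with
  | a :: al', b :: be' => (a < b)%N || ((a == b) && lex al' be')
  | _, _ => false
  end.

Lemma lexx al : lex al al = false.
Proof. by elim: al => //= a al ->; rewrite ltnn andbF. Qed.

Lemma lex_trans : transitive lex.
Proof.
move=> be; elim: be => [|b be IH] [|a al] [|c ga] //=.
move=> /orP[ab|/andP[/eqP -> ab]] /orP[bc|/andP[/eqP <- bc]].
- by rewrite (ltn_trans ab bc).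
- by rewrite ab.
- by rewrite bc.
- by rewrite eqxx (IH _ _ ab bc) orbT.
Qed.

Lemma pairwise_mons m n : pairwise lex (mons m n).
Proof.
elim: m n => [|m IH] n; first by case: n.
rewrite monsS; have : pairwise ltn (iota 0 n.+1).
  by rewrite -(sorted_pairwise ltn_trans) iota_ltn_sorted.
elim: (iota 0 n.+1) => //= a s IHs /andP[/allP as_ /IHs ps].
rewrite pairwise_cat ps andbT; apply/andP; split; last first.
  rewrite pairwise_map; apply: sub_pairwise (IH (n - a)%N) => b c /= ->.
  by rewrite eqxx orbT.
apply/allrelP => x y /mapP[b _ ->] /flatten_mapP[a' /as_ aa' /mapP[c _ ->]] /=.
by move: aa' => /= ->.
Qed.

Fixpoint addm (al be : seq nat) : seq nat :=
  match al, be with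
  | a :: al', b :: be' => (a + b)%N :: addm al' be'
  | _, _ => [::]
  end.

Lemma size_addm al be : size al = size be -> size (addm al be) = size al.
Proof. by elim: al be => [|a al IH] [|b be] //= [/IH ->]. Qed.

Lemma sumn_addm al be : size al = size be ->
  sumn (addm al be) = (sumn al + sumn be)%N.
Proof. by elim: al be => [|a al IH] [|b be] //= [/IH ->]; rewrite addnACA. Qed.

(** Compatibility of [lex] with products of monomials; it makes the nonstandard exponents upward
    closed. *)
Lemma lex_addm al be ga : size al = size ga -> size be = size ga ->
  lex (addm al ga) (addm be ga) = lex al be.
Proof.
elim: ga al be => [|c ga IH] [|a al] [|b be] //= [sa] [sb].
by rewrite ltn_add2r eqn_add2r IH.
Qed.

(** The componentwise order is divisibility of monomials, and [ga] is the exponent of the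
    cofactor. *)
Lemma leqm_addm al be : all2 leq al be ->
  exists2 ga, size ga = size al & be = addm al ga.
Proof.
elim: al be => [|a al IH] [|b be] //=; first by exists [::].
move=> /andP[ab /IH[ga sga ->]]; exists ((b - a)%N :: ga) => /=.
  by rewrite sga.
by rewrite subnKC.
Qed.

Lemma leqmm al : all2 leq al al.
Proof. by elim: al => //= a al ->; rewrite leqnn. Qed.

Lemma leqm_size al be : all2 leq al be -> size al = size be.
Proof. by rewrite all2E => /andP[/eqP]. Qed.

Definition upclosed m (E : pred (seq nat)) : Prop :=
  forall al be, size al = m -> all2 leq al be -> E al -> E be.

Lemma upclosed_slice m E a :
  upclosed m.+1 E -> upclosed m (fun b => E (a :: b)).
Proof. by move=> hE al be sal ab; apply: hE; rewrite /= ?sal // leqnn. Qed.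

Lemma upclosed_slice_le m E a a' b : upclosed m.+1 E -> size b = m ->
  (a <= a')%N -> E (a :: b) -> E (a' :: b).
Proof. by move=> hE sb aa'; apply: hE; rewrite /= ?sb // aa' leqmm. Qed.

Lemma upclosed_stable m (E : nat -> pred (seq nat)) :
  (forall i, upclosed m (E i)) ->
  (forall i al, size al = m -> E i al -> E i.+1 al) ->
  exists N, forall i al, (N <= i)%N -> size al = m -> E i al = E N al.
Proof.
elim: m E => [|m IH] E upE incE.
  have [[N EN]|nE] := pselect (exists N, E N [::]).
    exists N => i [|//] Ni _; rewrite EN; move: Ni => /subnK <-.
    by elim: (i - N)%N => [|j] //; rewrite addSn; apply: incE.
  have E0 i : E i [::] = false by apply/negP => Ei; apply: nE; exists i.
  by exists 0%N => i [|//] _ _; rewrite !E0.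
have incl i j al : (i <= j)%N -> size al = m.+1 -> E i al -> E j al.
  move=> /subnK <- sal; elim: (j - i)%N => // n IHn /IHn.
  by rewrite addSn; apply: incE.
(* The diagonal slices [E i (i :: b)] increase with [i], since both the set and the first exponent
   grow, so the induction hypothesis applies to them. *)
have [D hD] : exists D, forall i b, (D <= i)%N -> size b = m ->
    E i (i :: b) = E D (D :: b).
  apply: (IH (fun i b => E i (i :: b))) => [i|i b sb Eb].
    exact: upclosed_slice.
  by apply: incE; rewrite /= ?sb //; apply: upclosed_slice_le Eb.
have /choice[F hF] : forall a, exists N, forall i b, (N <= i)%N -> size b = m ->
    E i (a :: b) = E N (a :: b).
  move=> a; apply: (IH (fun i b => E i (a :: b))) => [i|i b sb].
    exact: upclosed_slice.
  by apply: incE; rewrite /= sb.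
(* The finitely many first exponents below [D] are treated one by one; the diagonal takes care of
   all others. *)
pose N := maxn D (\max_(a < D) F a).
have stab i a b : (N <= i)%N -> size b = m -> E i (a :: b) = E N (a :: b).
  move=> Ni sb; have [aD|Da] := ltnP a D.
    have FN : (F a <= N)%N.
      by rewrite leq_max (leq_bigmax (Ordinal aD)) orbT.
    by rewrite !(hF a) // (leq_trans FN).
  have DN : (D <= N)%N by rewrite leq_max leqnn.
  (* [E j (a :: b)] implies the diagonal slice at [maxn a j], which equals the one at [D], and the
     latter implies [E j (a :: b)] because [D <= a] and [D <= j]. *)
  have sand j : (N <= j)%N -> E j (a :: b) = E D (D :: b).
    move=> Nj; have Dj := leq_trans DN Nj; apply/idP/idP => [Ej|ED].
      rewrite -(hD (maxn a j)) ?(leq_trans Dj) ?leq_maxr //.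
      apply: (@upclosed_slice_le m _ a) => //; rewrite ?leq_maxl //.
      by apply: incl Ej; rewrite /= ?leq_maxr ?sb.
    apply: (@upclosed_slice_le m _ D) => //.
    by apply: incl ED; rewrite /= ?sb.
  by rewrite !sand.
by exists N => i [|a b] // Ni [sb]; apply: stab.
Qed.

Lemma evpoly_count_mons (R : realFieldType) m (E : pred (seq nat)) :
  upclosed m E -> evpoly R (fun n => count (predC E) (mons m n)).
Proof.
elim: m E => [|m IH] E upE.
  apply: (@evpoly_eq R (fun=> 0%N) _ 1%N); last exact: evpoly0.
  by case.
pose c a j := count (predC (fun b => E (a :: b))) (mons m j).
have evc a : evpoly R (c a) by apply/IH/upclosed_slice.
have [N hN] : exists N, forall a b, (N <= a)%N -> size b = m ->
    E (a :: b) = E (N :: b).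
  apply: (@upclosed_stable m (fun a b => E (a :: b))) => [a|a b sb].
    exact: upclosed_slice.
  exact: (@upclosed_slice_le m E).
have cN a j : (N <= a)%N -> c a j = c N j.
  move=> Na; apply: eq_in_count => b; rewrite mem_mons => /andP[/eqP sb _] /=.
  by rewrite hN.
(* The slices with [a < N] contribute finitely many shifted functions. The slices with [a >= N] all
   equal slice [N], and with [j = n - a] they contribute a partial sum of [c N]. *)
apply: (@evpoly_eq R (fun n =>
  \sum_(a <- iota 0 N) c a (n - a) + \sum_(j < n.+1 - N) c N j)%N _ N).
  move=> n Nn; rewrite count_monsS -(big_mkord xpredT (fun a => c a (n - a)%N)).
  rewrite (big_cat_nat (n := N)) ?leqW //=; congr (_ + _)%N.
    by rewrite /index_iota subn0.
  rewrite -(big_mkord xpredT) [RHS]big_nat_rev /=.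
  rewrite -[X in _ = bigop.body _ (index_iota X _) _]add0n big_addn.
  apply: eq_big_nat => j /andP[_ jn].
  by rewrite [RHS]cN; [congr (c _ _); lia | lia].
apply: evpolyD; first by apply: evpoly_sum => a; apply: evpoly_shift.
apply: (@evpoly_eq R (fun n => \sum_(j < (n - N).+1) c N j)%N _ N).
  by move=> n Nn; rewrite subSn.
apply: (@evpoly_shift R N (fun n => \sum_(j < n.+1) c N j)%N).
apply: (@evpoly_eq R (fun n => \sum_(j < n) c N j + c N n)%N _ 0%N).
  by move=> n _; rewrite big_ord_recr.
by apply: evpolyD => //; apply: evpoly_psum.
Qed.

(** * Hilbert functions and standard monomials *)

(** In a list sorted by [r] the predecessors of an entry are its [r]-smaller entries, so the greedy
    count becomes a condition on each entry that does not mention its position. *)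
Lemma nindep_count (k : fieldType) (C : lmodType k) (T : eqType) (r : rel T)
    (f : T -> C) (W : {pred C}) (s : seq T) :
  irreflexive r -> transitive r -> pairwise r s ->
  nindep W [seq f a | a <- s] =
  count (fun a => f a \notin addspan W [seq f b | b <- s & r b a]) s.
Proof.
move=> rr rt; elim: s W => [//|a s IH] W /= /andP[/allP as_ /IH ->].
rewrite rr; congr (_ + _)%N.
  have -> : [seq b <- s | r b a] = [::]; last by [].
  apply/eqP; rewrite -(negbK (_ == _)) -has_filter; apply/hasPn => b /as_ ab.
  by apply/negP => /(rt _ _ _ ab); rewrite rr.
by apply: eq_in_count => b /as_ ->.
Qed.

Fixpoint ev (S : comNzRingType) (xs : seq S) (al : seq nat) : S :=
  match xs, al with
  | x :: xs', a :: al' => x ^+ a * ev xs' al'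
  | _, _ => 1
  end.

Lemma ev_addm (S : comNzRingType) (xs : seq S) (al be : seq nat) :
  size al = size be -> ev xs (addm al be) = ev xs al * ev xs be.
Proof.
elim: xs al be => [|x xs IH] [|a al] [|b be] //=; rewrite ?mulr1 // => -[sab].
by rewrite IH // exprD mulrACA.
Qed.

Lemma ev_nseq0 (S : comNzRingType) (xs : seq S) :
  ev xs (nseq (size xs) 0%N) = 1.
Proof. by elim: xs => //= x xs ->; rewrite expr0 mulr1. Qed.

Lemma ev_gen (S : comNzRingType) (xs : seq S) (x : S) : x \in xs ->
  exists al, [/\ size al = size xs, sumn al = 1%N & ev xs al = x].
Proof.
elim: xs => //= y ys IH; rewrite inE => /orP[/eqP ->|/IH[al [sal nal <-]]].
  exists (1%N :: nseq (size ys) 0%N).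
  by rewrite /= size_nseq sumn_nseq ev_nseq0 mulr1.
by exists (0%N :: al); rewrite /= sal nal expr0 mul1r.
Qed.

(** This lets [addspan_min] treat one factor of a product at a time. *)
Lemma submod_premul (k : fieldType) (B : comAlgType k) (U : {pred B}) (x : B) :
  submod_closed U -> submod_closed [pred w | x * w \in U].
Proof.
move=> sU; split; first by rewrite inE /= mulr0; case: sU.
move=> a u v; rewrite !inE /= mulrDr -scalerAr => hu hv.
by apply: submodD => //; apply: submodZ.
Qed.

(** * Graded algebras, their monomial spanning sets and standard monomials *)

Section Graded.
Variables (k : fieldType) (B : comAlgType k) (T : {pred B}).
Variable T_ : nat -> {pred B}.
Hypothesis gT : standard_graded T T_.

Let sT n : submod_closed (T_ n). Proof. exact: sg_submod gT n. Qed.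

Lemma gr1 : 1 \in T_ 0%N.
Proof. by apply/(sg_base gT); exists 1; rewrite scale1r. Qed.

Lemma ev_gr (xs : seq B) (al : seq nat) : {subset xs <= T_ 1%N} ->
  size al = size xs -> ev xs al \in T_ (sumn al).
Proof.
elim: xs al => [|x xs IH] [|a al] //= xsT; first by rewrite gr1.
move=> [sal]; apply: (sg_mul gT).
  elim: a => [|a IHa]; first exact: gr1.
  by rewrite exprS -add1n; apply: (sg_mul gT) => //; apply/xsT/mem_head.
by apply: IH => // y yxs; apply: xsT; rewrite inE yxs orbT.
Qed.

(* A sum of homogeneous components x_n is encoded by the polynomial whose
   coefficients are the x_n, and recovered by evaluation at 1; products of
   polynomials then compute the components of products. *)
Definition homog (I : nat -> {pred B}) (p : {poly B}) : Prop :=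
  forall n, p`_n \in I n.

Lemma homogD I p q : (forall n, submod_closed (I n)) ->
  homog I p -> homog I q -> homog I (p + q).
Proof. by move=> sI hp hq n; rewrite coefD; apply: submodD. Qed.

Lemma homogB I p q : (forall n, submod_closed (I n)) ->
  homog I p -> homog I q -> homog I (p - q).
Proof. by move=> sI hp hq n; rewrite coefB; apply: submodB. Qed.

Lemma homogZ I a p : (forall n, submod_closed (I n)) ->
  homog I p -> homog I (a%:A *: p).
Proof. by move=> sI hp n; rewrite coefZ mulr_algl; apply: submodZ. Qed.

Lemma homogM I J p q : (forall n, submod_closed (J n)) ->
  (forall m n x y, x \in I m -> y \in J n -> x * y \in J (m + n)%N) ->
  homog I p -> homog J q -> homog J (p * q).
Proof.
move=> sJ IJ hp hq n; rewrite coefM; apply: submod_sum => // i _.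
have -> : J n = J (i + (n - i))%N by rewrite subnKC // -ltnS.
exact: IJ.
Qed.

Lemma homogXn I n x : (forall n, submod_closed (I n)) ->
  x \in I n -> homog I (x *: 'X^n).
Proof.
move=> sI xI i; rewrite coefZ coefXn; case: eqP => [->|_].
  by rewrite mulr1.
by rewrite mulr0; case: (sI i).
Qed.

Lemma homog_decomp x : x \in T -> exists2 p, homog T_ p & p.[1] = x.
Proof.
move=> /(sg_span gT)[N [c [cT ->]]]; exists (\poly_(i < N) c i).
  by move=> n; rewrite coef_poly; case: ifP => // _; case: (sT n).
by rewrite horner_poly; apply: eq_bigr => i _; rewrite expr1n mulr1.
Qed.

Lemma homog_eq0 p : homog T_ p -> p.[1] = 0 -> p = 0.
Proof.
move=> hp; rewrite horner_coef => p0.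
have h := @sg_direct _ _ _ _ gT (size p) (fun n => p`_n) hp.
apply/polyP => n; rewrite coef0; have [np|] := ltnP n (size p); last first.
  by apply: nth_default.
apply: h np; rewrite -[RHS]p0.
by apply: eq_bigr => i _; rewrite expr1n mulr1.
Qed.

Lemma homog_inj p q : homog T_ p -> homog T_ q -> p.[1] = q.[1] -> p = q.
Proof.
move=> hp hq pq; apply/eqP; rewrite -subr_eq0; apply/eqP.
by apply: homog_eq0; [exact: homogB|rewrite hornerD hornerN pq subrr].
Qed.

Variable xs : seq B.
Hypothesis xsT : {subset xs <= T_ 1%N}.
Hypothesis xs_gen :
  forall S : {pred B}, subalg_closed S -> {subset xs <= S} -> {subset T <= S}.

Let m := size xs.

Let M n : {pred B} := addspan (pred1 0) [seq ev xs al | al <- mons m n].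

Let sM n : submod_closed (M n).
Proof. exact/submod_addspan/submod_pred1_0. Qed.

Let evM al : size al = m -> ev xs al \in M (sumn al).
Proof.
move=> sal; apply: mem_addspan; first exact: submod_pred1_0.
by apply: map_f; rewrite mem_mons sal !eqxx.
Qed.

Let M_min n (U : {pred B}) : submod_closed U ->
  (forall al, size al = m -> sumn al = n -> ev xs al \in U) ->
  {subset M n <= U}.
Proof.
move=> sU hU; apply: addspan_min => //.
  by move=> x; rewrite inE => /eqP ->; case: sU.
by move=> x /mapP[al]; rewrite mem_mons => /andP[/eqP ? /eqP ?] ->; apply: hU.
Qed.

Let MM i j x y : x \in M i -> y \in M j -> x * y \in M (i + j)%N.
Proof.
move=> xM yM.
have : x \in [pred w | y * w \in M (i + j)%N]; last by rewrite inE /= mulrC.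
move: x xM; apply: M_min; first exact: submod_premul.
move=> al sal <-; rewrite inE /= mulrC.
have : y \in [pred w | ev xs al * w \in M (sumn al + j)%N]; last by [].
move: y yM; apply: M_min; first exact: submod_premul.
move=> be sbe <-; rewrite inE /= -ev_addm ?sal ?sbe //.
by rewrite -sumn_addm ?sal ?sbe //; apply: evM; rewrite size_addm ?sal.
Qed.

(** The sums of components taken from the [M i] form a subalgebra containing the generators, hence
    all of [T]. By uniqueness of components, an element of [T_ n] is then its own component in
    [M n]. *)
Lemma gr_span n : T_ n =i M n.
Proof.
have MT i : {subset M i <= T_ i}.
  by apply: M_min => // al sal <-; apply: ev_gr.
move=> x; apply/idP/idP; last exact: MT.
pose S : {pred B} := [pred z | `[< exists2 p, homog M p & p.[1] = z >]].
have inS z : (z \in S) <-> exists2 p, homog M p & p.[1] = z by rewrite inE.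
have TS : {subset T <= S}.
  apply: xs_gen.
    split.
    - apply/inS; exists 1; last by rewrite hornerC.
      move=> i; rewrite coef1; case: eqP => [->|_]; last by case: (sM i).
      rewrite -(ev_nseq0 xs) -[X in M X](mul0n m) -sumn_nseq.
      by apply: evM; rewrite size_nseq.
    - move=> a u v /inS[p hp <-] /inS[q hq <-]; apply/inS.
      exists (a%:A *: p + q); first by apply: homogD => //; apply: homogZ.
      by rewrite hornerD hornerZ mulr_algl.
    - move=> u v /inS[p hp <-] /inS[q hq <-]; apply/inS.
      exists (p * q); last by rewrite hornerM.
      exact: homogM sM MM hp hq.
  move=> y yxs; apply/inS; exists (y *: 'X^1).
    apply: homogXn => //.
    by have [al [sal <- <-]] := ev_gen yxs; apply: evM.
  by rewrite hornerZ hornerXn mulr1.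
move=> xT; have /TS/inS[p hp px] := sg_sub gT xT.
have hpT : homog T_ p by move=> i; apply: MT.
have := homog_inj hpT (homogXn sT xT).
rewrite hornerZ hornerXn expr1n mulr1 => /(_ px).
move=> /(congr1 (fun q : {poly B} => q`_n)).
by rewrite coefZ coefXn eqxx mulr1 => <-.
Qed.

Definition hideal (I : nat -> {pred B}) : Prop :=
  [/\ forall n, submod_closed (I n), forall n, {subset I n <= T_ n} &
      forall i j x y, x \in T_ i -> y \in I j -> x * y \in I (i + j)%N].

Lemma hideal0 : hideal (fun=> pred1 0).
Proof.
split=> [n|n x|i j x y _].
- exact: submod_pred1_0.
- by rewrite inE => /eqP ->; case: (sT n).
- by rewrite !inE => /eqP ->; rewrite mulr0.
Qed.

Implicit Type I J : nat -> {pred B}.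

(** For a homogeneous ideal [I], these are the exponents of the initial ideal, with respect to
    [lex], of the preimage of [I] in the polynomial ring. *)
Definition nonstd I (al : seq nat) : bool :=
  ev xs al \in addspan (I (sumn al))
    [seq ev xs be | be <- mons m (sumn al) & lex be al].

Definition hilb I n : nat := count (predC (nonstd I)) (mons m n).

(** The standard monomials are those kept by the greedy choice along [mons m n], which is listed in
    increasing order. *)
Lemma qdim_hilb I n : hideal I -> qdim (T_ n) (I n) (hilb I n).
Proof.
move=> [sI IT _].
have -> : hilb I n = nindep (I n) [seq ev xs al | al <- mons m n].
  rewrite (nindep_count _ _ lexx lex_trans (pairwise_mons m n)).
  apply: eq_in_count => al; rewrite mem_mons => /andP[_ /eqP sal].
  by rewrite /= /nonstd sal.
apply: qdim_ext (qdim_addspan _ (sI n)) => // x; apply/idP/idP.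
  apply: addspan_min; [exact: sT|exact: IT|move=> _ /mapP[al + ->]].
  by rewrite mem_mons => /andP[/eqP sal /eqP <-]; apply: ev_gr.
rewrite gr_span; apply: addspan_sub => // y; rewrite inE => /eqP ->.
by case: (sI n).
Qed.

(** Multiplying a congruence that expresses [ev xs al] by smaller monomials with [ev xs ga] keeps it
    modulo [I] and keeps the monomials smaller. *)
Lemma nonstd_up I : hideal I -> upclosed m (nonstd I).
Proof.
move=> [sI IT IM] al be sal alb; have := leqm_size alb.
have [ga sga ->] := leqm_addm alb => sbe.
rewrite /nonstd sumn_addm // ev_addm //.
set U := addspan (I (_ + _)%N) _ => al_ns.
have sU : submod_closed U by apply: submod_addspan.
rewrite mulrC; suff : ev xs al \in [pred w | ev xs ga * w \in U] by [].
move: (ev xs al) al_ns; apply: addspan_min; first exact: submod_premul.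
- move=> y yI; rewrite inE /=; apply: sub_addspan; rewrite addnC.
  by apply: IM => //; apply: ev_gr; rewrite // sga sal.
- move=> _ /mapP[de + ->]; rewrite mem_filter mem_mons.
  move=> /andP[lde /andP[/eqP sde /eqP nde]].
  have sdg : size de = size ga by rewrite sde sga.
  rewrite inE /= mulrC -ev_addm //.
  apply: mem_addspan => //; apply: map_f.
  rewrite mem_filter mem_mons lex_addm // lde size_addm // sumn_addm // sde nde.
  by rewrite !eqxx.
Qed.

Lemma evpoly_hilb (R : realFieldType) I : hideal I -> evpoly R (hilb I).
Proof. by move=> hI; apply/evpoly_count_mons/nonstd_up. Qed.

End Graded.

(** * Growth of Hilbert functions and chains of primes *)

(** [small j] is the growth of a polynomial of degree less than [j], the zero polynomial for
    [j = 0]. The base [n.+1] is positive, so the bound can be required from [n = 0] on. *)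
Definition small (j : nat) (f : nat -> nat) : Prop :=
  if j is j'.+1 then exists c, forall n, (f n <= c * n.+1 ^ j')%N
  else exists N, forall n, (N <= n)%N -> f n = 0%N.

Lemma leq_expl j a b : (a <= b)%N -> (a ^ j <= b ^ j)%N.
Proof. by case: j => // j; rewrite leq_exp2r. Qed.

Section Small.
Implicit Types (f g : nat -> nat).

Lemma small_le j f g : (forall n, f n <= g n)%N -> small j g -> small j f.
Proof.
move=> fg; case: j => [|j] /= [c hc]; exists c => n.
  by move=> cn; apply/eqP; rewrite -leqn0 -(hc n).
exact: leq_trans (hc n).
Qed.

Lemma smallD j f g : small j f -> small j g -> small j (fun n => f n + g n)%N.
Proof.
case: j => [|j] /= [c hc] [d hd].
  exists (maxn c d) => n; rewrite geq_max => /andP[cn dn].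
  by rewrite hc // hd.
by exists (c + d)%N => n; rewrite mulnDl leq_add.
Qed.

Lemma small_shift j a f : small j f ->
  small j (fun n => if (a <= n)%N then f (n - a)%N else 0%N).
Proof.
case: j => [|j] /= [c hc].
  by exists (c + a)%N => n cn; rewrite hc ?if_same //; lia.
exists c => n; case: ifP => // _; apply: leq_trans (hc _) _.
by rewrite leq_mul2l leq_expl ?orbT // ltnS leq_subr.
Qed.

Lemma small_psum j f : small j f -> small j.+1 (fun n => \sum_(i < n.+1) f i)%N.
Proof.
case: j => [|j] /= [c hc].
  exists (\sum_(i < c) f i)%N => n; rewrite expn0 muln1.
  rewrite -!(big_mkord xpredT); have [cn|nc] := leqP c n.+1.
    rewrite (big_cat_nat (n := c)) //= [X in (_ + X)%N]big1_seq ?addn0 //.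
    by move=> i; rewrite mem_index_iota => /andP[_ /andP[ci _]]; apply: hc.
  by rewrite [leqRHS](big_cat_nat (n := n.+1)) ?leq_addr //= ltnW.
exists c => n; apply: (@leq_trans (\sum_(i < n.+1) c * n.+1 ^ j)%N).
  apply: leq_sum => i _; apply: leq_trans (hc i) _.
  by rewrite leq_mul2l leq_expl ?orbT.
by rewrite sum_nat_const card_ord expnS mulnCA.
Qed.

Lemma small_ev0 j f : small 0 f -> small j f.
Proof.
case: j => [//|j] [N hN]; exists (\sum_(i < N) f i)%N => n.
have [/hN -> //|nN] := leqP N n.
apply: leq_trans (leq_pmulr _ _); last by rewrite expn_gt0.
by rewrite (bigD1 (Ordinal nN)) //= leq_addr.
Qed.

End Small.

(** * Homogeneous ideals: maximal elements, sums, colons and primes *)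

Section HomogeneousIdeals.
Variables (k : fieldType) (B : comAlgType k) (B_ : nat -> {pred B}).
Hypothesis gB : standard_graded predT B_.
Variable xs : seq B.
Hypothesis xsB : {subset xs <= B_ 1%N}.
Hypothesis xs_gen :
  forall S : {pred B}, subalg_closed S -> {subset xs <= S} ->
    {subset (predT : {pred B}) <= S}.
Implicit Types (I J Q : nat -> {pred B}) (x y z : B).

Notation hideal := (hideal B_).

Let sB n : submod_closed (B_ n). Proof. exact: sg_submod gB n. Qed.

Let qdim_hilbB I n : hideal I -> qdim (B_ n) (I n) (hilb xs I n).
Proof. move=> hI; exact: (qdim_hilb gB xsB xs_gen n hI). Qed.

Lemma hilb_full I n : hideal I -> {subset B_ n <= I n} -> hilb xs I n = 0%N.
Proof.
move=> hI BI; have [sI IB _] := hI.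
apply: (qdim_uniq (sI n) (qdim_hilbB n hI)).
apply: qdim_ext (qdim_refl (sI n)) => // y.
by apply/idP/idP => [/IB|/BI].
Qed.

Lemma hilb_eq I J n : hideal I -> hideal J -> I n =i J n ->
  hilb xs I n = hilb xs J n.
Proof.
move=> hI hJ IJ; have [sJ _ _] := hJ.
apply: (qdim_uniq (sJ n)) (qdim_hilbB n hJ).
exact: qdim_ext IJ (qdim_hilbB n hI).
Qed.

Lemma nonstd_sub I J al : hideal J -> (forall n, {subset I n <= J n}) ->
  nonstd xs I al -> nonstd xs J al.
Proof. by move=> [sJ _ _] IJ; apply: addspan_sub. Qed.

(** Noetherianity. Without such a [Q], dependent choice gives a strictly increasing chain of ideals.
    Their nonstandard exponents stabilize by [upclosed_stable], so two consecutive ideals have the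
    same Hilbert function and coincide by [qdim_eq_sub]. *)
Lemma hideal_max (P : (nat -> {pred B}) -> Prop) I : hideal I -> P I ->
  exists Q, [/\ hideal Q, P Q, forall n, {subset I n <= Q n} &
    forall J, hideal J -> P J -> (forall n, {subset Q n <= J n}) ->
      forall n, {subset J n <= Q n}].
Proof.
move=> hI PI; apply: contrapT => noQ.
pose S := {Q | [/\ hideal Q, P Q & forall n, {subset I n <= Q n}]}.
pose lt (Q J : S) := (forall n, {subset sval Q n <= sval J n}) /\
  ~ (forall n, {subset sval J n <= sval Q n}).
have step : forall Q : S, {J : S | lt Q J}.
  move=> [Q [hQ PQ IQ]]; apply: cid; apply: contrapT => noJ; apply: noQ.
  exists Q; split=> // J hJ PJ QJ; apply: contrapT => JQ; apply: noJ.
  have hS : [/\ hideal J, P J & forall n, {subset I n <= J n}].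
    by split=> // n y /IQ /QJ.
  by exists (exist _ J hS).
have hSI : [/\ hideal I, P I & forall n, {subset I n <= I n}].
  by split=> // n y.
have [f [_ flt]] := dependent_choice step (exist _ I hSI).
pose F i := sval (f i).
have hF i : hideal (F i) by rewrite /F; case: (f i) => ? [].
have FS i : forall n, {subset F i n <= F i.+1 n} by move: (flt i).1.
have [N hN] : exists N, forall i al, (N <= i)%N -> size al = size xs ->
    nonstd xs (F i) al = nonstd xs (F N) al.
  apply: upclosed_stable => [i|i al _]; first exact: (nonstd_up gB xsB (hF i)).
  exact: nonstd_sub.
case: (flt N) => _; apply => n.
have [sN NB _] := hF N; have [sN1 N1B _] := hF N.+1.
apply: (qdim_eq_sub (sB n) (sN n) (sN1 n) (@FS N n) (@N1B n)).
  exact: qdim_hilbB.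
suff <- : hilb xs (F N.+1) n = hilb xs (F N) n by apply: qdim_hilbB.
apply: eq_in_count => al; rewrite mem_mons => /andP[/eqP sal _] /=.
by rewrite -(hN N.+1).
Qed.

(** The components of the shifted module [B(-a)]. Without the case distinction, truncated
    subtraction would put [B_ 0] in every degree below [a]. *)
Let shifted a n : {pred B} := if (a <= n)%N then B_ (n - a)%N else pred1 0.

Let s_shifted a n : submod_closed (shifted a n).
Proof. by rewrite /shifted; case: ifP => // _; apply: submod_pred1_0. Qed.

Definition hadd Q a x n : {pred B} :=
  [pred z | `[< exists2 w, w \in (if (a <= n)%N then B_ (n - a)%N else pred1 0)
                         & z - x * w \in Q n >]].

Definition hcolon Q a x n : {pred B} :=
  [pred z | (z \in B_ n) && (x * z \in Q (a + n)%N)].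

Let in_hadd Q a x n z :
  (z \in hadd Q a x n) <-> exists2 w, w \in shifted a n & z - x * w \in Q n.
Proof. by rewrite inE. Qed.

Lemma hideal_hadd Q a x : x \in B_ a -> hideal Q -> hideal (hadd Q a x).
Proof.
move=> xB [sQ QB QM]; split.
- move=> n; split.
    apply/in_hadd; exists 0; first by case: (s_shifted a n).
    by rewrite mulr0 subr0; case: (sQ n).
  move=> c u v /in_hadd[w wB uw] /in_hadd[t tB vt]; apply/in_hadd.
  exists (c *: w + t); first by apply: submodD => //; apply: submodZ.
  rewrite mulrDr -scalerAr opprD addrACA -scalerBr.
  by apply: submodD => //; apply: submodZ.
- move=> n z /in_hadd[w wB /QB zw]; apply: submodBr zw _ => //.
  move: wB; rewrite /shifted; case: ifP => [an wB|_].
    by rewrite -(subnKC an); apply: (sg_mul gB).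
  by rewrite inE => /eqP ->; rewrite mulr0; case: (sB n).
- move=> i j u z uB /in_hadd[w wB zw]; apply/in_hadd; exists (u * w).
    move: wB; rewrite /shifted; case: ifP => [aj wB|_]; last first.
      rewrite inE => /eqP ->; rewrite mulr0.
      by case: ifP => _; [case: (sB (i + j - a)%N)|rewrite inE].
    rewrite (leq_trans aj (leq_addl _ _)) -addnBA //.
    exact: (sg_mul gB).
  by rewrite mulrCA -mulrBr; apply: QM.
Qed.

Lemma hideal_hcolon Q a x : x \in B_ a -> hideal Q -> hideal (hcolon Q a x).
Proof.
move=> xB [sQ QB QM]; split.
- move=> n; split.
    by rewrite inE mulr0; case: (sB n) => -> _; case: (sQ (a + n)%N) => ->.
  move=> c u v; rewrite !inE => /andP[uB uQ] /andP[vB vQ].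
  rewrite mulrDr -scalerAr.
  by apply/andP; split; apply: submodD => //; apply: submodZ.
- by move=> n z; rewrite inE => /andP[].
- move=> i j u z uB; rewrite !inE => /andP[zB zQ].
  by rewrite (sg_mul gB) //= mulrCA addnCA; apply: QM.
Qed.

Lemma sub_hadd Q a x n : hideal Q -> {subset Q n <= hadd Q a x n}.
Proof.
move=> [sQ _ _] z zQ; apply/in_hadd; exists 0; last by rewrite mulr0 subr0.
by case: (s_shifted a n).
Qed.

Lemma mem_hadd Q a x : hideal Q -> x \in hadd Q a x a.
Proof.
move=> [sQ _ _]; apply/in_hadd; exists 1.
  by rewrite /shifted leqnn subnn; apply: gr1 gB.
by rewrite mulr1 subrr; case: (sQ a).
Qed.

Lemma sub_hcolon Q a x n : x \in B_ a -> hideal Q ->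
  {subset Q n <= hcolon Q a x n}.
Proof.
by move=> xB [_ QB QM] z zQ; rewrite inE (QB _ _ zQ) /=; apply: QM.
Qed.

(* 0 -> B/(Q : x) (-a) -> B/Q -> B/(Q + xB) -> 0 is exact. *)
Lemma hilb_hadd Q a x n : x \in B_ a -> hideal Q ->
  hilb xs Q n = ((if (a <= n)%N then hilb xs (hcolon Q a x) (n - a) else 0) +
                 hilb xs (hadd Q a x) n)%N.
Proof.
move=> xB hQ; have hA := hideal_hadd xB hQ; have hC := hideal_hcolon xB hQ.
have [sQ QB QM] := hQ; have [sA AB _] := hA; have [sC CB _] := hC.
apply: (qdim_uniq (sQ n) (qdim_hilbB n hQ)).
apply: (@qdim_add _ _ _ (hadd Q a x n)) (qdim_hilbB n hA) => //.
  exact: sub_hadd.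
have [an|na] := leqP a n.
  pose f : {linear B -> B} := (x \*o idfun).
  apply: (@qdim_map _ _ _ f _ _ _ _ _ _ _ _ _ _ (qdim_hilbB (n - a) hC)) => //.
  - move=> z zB; apply/in_hadd; exists z; first by rewrite /shifted an.
    by rewrite subrr; case: (sQ n).
  - by move=> z zB; rewrite inE zB /= subnKC.
  - by move=> z /in_hadd[w]; rewrite /shifted an => wB zw; exists w.
apply: qdim_ext (qdim_refl (sQ n)) => // z; apply/idP/idP.
  exact: sub_hadd.
move=> /in_hadd[w]; rewrite /shifted leqNgt na inE => /eqP ->.
by rewrite mulr0 subr0.
Qed.

(** Primality is tested on homogeneous elements only; [prime_htotal] shows that this suffices. *)
Definition hprime Q : Prop :=
  1 \notin Q 0%N /\
  forall a b x y, x \in B_ a -> y \in B_ b -> x * y \in Q (a + b)%N ->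
    x \in Q a \/ y \in Q b.

Definition htotal I : {pred B} :=
  [pred z | `[< exists2 p, homog I p & p.[1] = z >]].

Lemma in_htotal I z : (z \in htotal I) <-> exists2 p, homog I p & p.[1] = z.
Proof. by rewrite inE. Qed.

Lemma htotal_sub I J : (forall n, {subset I n <= J n}) ->
  {subset htotal I <= htotal J}.
Proof.
by move=> IJ z /in_htotal[p hp <-]; apply/in_htotal; exists p => // n; apply/IJ.
Qed.

Lemma htotal_homog I n z :
  hideal I -> z \in B_ n -> (z \in htotal I) = (z \in I n).
Proof.
move=> [sI IB _] zB; apply/idP/idP => [/in_htotal[p hp pz]|zI].
  have hpB : homog B_ p by move=> i; apply: IB.
  have := homog_inj gB hpB (homogXn sB zB).
  rewrite hornerZ hornerXn expr1n mulr1 => /(_ pz).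
  move=> /(congr1 (fun q : {poly B} => q`_n)).
  by rewrite coefZ coefXn eqxx mulr1 => <-.
apply/in_htotal; exists (z *: 'X^n); first exact: homogXn.
by rewrite hornerZ hornerXn expr1n mulr1.
Qed.

(** If [u] and [v] are outside, let [p_i] and [q_j] be their components of least degree outside [Q].
    In the component of [u * v] of degree [i + j] every other product lies in [Q], hence so does
    [p_i * q_j], against [hprime Q]. *)
Lemma prime_htotal Q : hideal Q -> hprime Q -> prime_ideal (htotal Q).
Proof.
move=> hQ [Q1 Qp]; have [sQ QB QM] := hQ; split.
  split.
  - apply/in_htotal; exists 0; last by rewrite horner0.
    by move=> n; rewrite coef0; case: (sQ n).
  - by rewrite (htotal_homog hQ (gr1 gB)).
  - move=> a u v /in_htotal[p hp <-] /in_htotal[q hq <-]; apply/in_htotal.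
    have [r hr <-] := homog_decomp gB (isT : a \in (predT : {pred B})).
    exists (r * p + q); last by rewrite hornerD hornerM.
    by apply: homogD => //; apply: homogM hr hp.
move=> u v /in_htotal[r hr ruv].
have [p hp pu] := homog_decomp gB (isT : u \in (predT : {pred B})).
have [q hq qv] := homog_decomp gB (isT : v \in (predT : {pred B})).
have rpq : r = p * q.
  apply: (homog_inj gB); first by move=> n; apply/QB/hr.
    exact: homogM sB (sg_mul gB) hp hq.
  by rewrite ruv hornerM pu qv.
have first_bad (s : {poly B}) w : s.[1] = w -> w \notin htotal Q ->
    exists2 i, s`_i \notin Q i & forall i', (i' < i)%N -> s`_i' \in Q i'.
  move=> sw wQ; have exi : exists i, s`_i \notin Q i.
    apply: contrapT => nex; case/negP: wQ; apply/in_htotal.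
    by exists s => // n; apply: contraT => sn; case: nex; exists n.
  have [i si mini] := ex_minnP exi; exists i => // i' i'i.
  by apply: contraT => /mini; rewrite leqNgt i'i.
apply: contraT; rewrite negb_or => /andP[/(first_bad _ _ pu)[i pi ltp]].
move=> /(first_bad _ _ qv)[j qj ltq].
have : p`_i * q`_j \in Q (i + j)%N.
  have ilt : (i < (i + j).+1)%N by rewrite ltnS leq_addr.
  have := hr (i + j)%N; rewrite rpq coefM (bigD1 (Ordinal ilt)) //= addKn => hs.
  rewrite -(addrK (\sum_(s < (i + j).+1 | s != Ordinal ilt)
    p`_s * q`_(i + j - s)) (p`_i * _)); apply: submodB => //.
  apply: submod_sum => // s si; have sl : (s <= i + j)%N by rewrite -ltnS.
  have : nat_of_ord s != i by [].
  rewrite neq_ltn => /orP[si'|is'].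
    have -> : Q (i + j)%N = Q (i + j - s + s)%N by rewrite subnK.
    by rewrite mulrC; apply: QM; [exact: hq|exact: ltp].
  have -> : Q (i + j)%N = Q (s + (i + j - s))%N by rewrite subnKC.
  apply: QM; first exact: hp.
  by apply: ltq; lia.
by case/(Qp _ _ _ _ (hp i) (hq j)) => h; [rewrite h in pi|rewrite h in qj].
Qed.

(** Indexed so that [big j I] yields a chain of primes of length [j] above [I]; for [j = 0] it is
    enough that [I] be proper. *)
Definition big j I : Prop :=
  if j is j'.+1 then ~ small j' (hilb xs I) else 1 \notin I 0%N.

(** If [x * y] is in [Q] but neither factor is, then [Q + xB] and [Q : x] are strictly larger than
    [Q], as they contain [x] and [y]. By maximality both Hilbert functions are small, and by
    [hilb_hadd] so is that of [Q]. *)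
Lemma maximal_big_prime j Q : hideal Q -> big j.+1 Q ->
  (forall J, hideal J -> big j.+1 J -> (forall n, {subset Q n <= J n}) ->
     forall n, {subset J n <= Q n}) ->
  hprime Q.
Proof.
move=> hQ Qbig Qmax; have [sQ QB QM] := hQ; split.
  apply/negP => Q1; apply: Qbig; apply: small_ev0; exists 0%N => n _.
  by apply: hilb_full => // y yB; rewrite -[y]mulr1 -(addn0 n); apply: QM.
move=> a b x y xB yB xyQ; apply: contrapT => /not_orP[xQ yQ]; apply: Qbig.
have hA := hideal_hadd xB hQ; have hC := hideal_hcolon xB hQ.
have smallA : small j (hilb xs (hadd Q a x)).
  apply: contrapT => bigA; apply: xQ.
  by apply: (Qmax _ hA bigA) (mem_hadd _ _ hQ) => n; apply: sub_hadd.
have smallC : small j (hilb xs (hcolon Q a x)).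
  apply: contrapT => bigC; apply: yQ.
  apply: (Qmax _ hC bigC) => [n|]; first exact: sub_hcolon.
  by rewrite inE yB.
apply: small_le (smallD (small_shift a smallC) smallA) => n.
by rewrite (hilb_hadd n xB hQ).
Qed.

Definition irrelevant n : {pred B} := if n is 0 then pred1 0 else B_ n.

Lemma hideal_irrelevant : hideal irrelevant.
Proof.
split=> [[|n]|[|n] x|i [|j] x y xB] //=.
- exact: submod_pred1_0.
- by rewrite inE => /eqP ->; case: (sB 0%N).
- rewrite inE => /eqP ->; rewrite mulr0.
  by case: (i + 0)%N => [|n]; [rewrite inE|case: (sB n.+1)].
- by rewrite addnS => yB /=; rewrite -addnS; apply: (sg_mul gB).
Qed.

Lemma hprime_irrelevant : hprime irrelevant.
Proof.
split; first by rewrite inE oner_eq0.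
move=> [|a] [|b] x y xB yB; [|by right|by left|by left].
move: xB yB => /(sg_base gB)[c ->] /(sg_base gB)[d ->].
rewrite /= !inE -scalerAl mul1r scalerA scaler_eq0 oner_eq0 orbF mulf_eq0.
by case/orP => /eqP ->; rewrite scale0r; [left|right].
Qed.

Lemma hideal_sub_irrelevant I n : hideal I -> 1 \notin I 0%N ->
  {subset I n <= irrelevant n}.
Proof.
move=> [sI IB _] I1; case: n => [|n] x xI /=; last exact: IB.
have /(sg_base gB)[c xc] := IB _ _ xI; rewrite inE xc.
have [-> | c0] := eqVneq c 0; first by rewrite scale0r.
by case/negP: I1; rewrite -(scalerK c0 1) -xc; apply: submodZ.
Qed.

(** Otherwise [Q] contains all generators, hence every monomial of positive degree, and its Hilbert
    function vanishes from degree 1 on. *)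
Lemma hprime_degree1 j Q : hideal Q -> big j.+1 Q ->
  exists2 x, x \in B_ 1%N & x \notin Q 1%N.
Proof.
move=> hQ Qbig; have [sQ QB QM] := hQ; apply: contrapT => noX.
have xsQ : {subset xs <= Q 1%N}.
  by move=> x xxs; apply: contraT => xQ; case: noX; exists x => //; apply: xsB.
apply: Qbig; apply: small_ev0; exists 1%N => n n0; apply: hilb_full => //.
move=> y; rewrite (gr_span gB xsB xs_gen).
apply: addspan_min => // [z|_ /mapP[al + ->]].
  by rewrite inE => /eqP ->; case: (sQ n).
rewrite mem_mons => /andP[/eqP sal /eqP nal].
(* The first generator with a positive exponent puts the whole monomial in [Q]. *)
move: n0; rewrite -nal; elim: (xs) xsB xsQ al sal {nal} =>
  [|x s IH] sB' sQ' [|a al] //=.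
move=> [sal] a0; have xQ := sQ' _ (mem_head _ _).
case: a a0 => [|a] a0.
  by rewrite expr0 mul1r; apply: IH => // z zs; [apply: sB'|apply: sQ'];
     rewrite inE zs orbT.
rewrite exprSr mulrAC addSn -addn1; apply: QM => //.
exact: (ev_gr gB (xs := x :: s) (al := a :: al)) (congr1 S sal).
Qed.

Lemma prime_chain_big j I : hideal I -> big j I ->
  exists2 P : nat -> {pred B}, prime_chain j P & {subset htotal I <= P 0%N}.
Proof.
elim: j I => [|j IH] I hI bigI.
  exists (fun=> htotal irrelevant).
    split=> // i _; apply: prime_htotal; first exact: hideal_irrelevant.
    exact: hprime_irrelevant.
  by apply: htotal_sub => n; apply: hideal_sub_irrelevant.
have [Q [hQ bigQ IQ Qmax]] := hideal_max hI bigI.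
have pQ := maximal_big_prime hQ bigQ Qmax.
have [x xB xQ] := hprime_degree1 hQ bigQ.
have hJ := hideal_hadd xB hQ.
set J := hadd Q 1%N x in hJ.
(* For [j = 0], adding the degree 1 element [x] changes nothing in degree 0, so [J] stays proper.
   For [j > 0], primality gives [Q : x = Q], so the Hilbert function of [Q] is bounded by the
   partial sums of that of [J]; were the latter small, [small_psum] would contradict [bigQ]. *)
have bigJ : big j J.
  case: j bigQ {IH bigI Qmax} => [|j] bigQ /=.
    apply/negP; rewrite /J => /in_hadd[w]; rewrite /shifted /= inE => /eqP ->.
    by rewrite mulr0 subr0; apply/negP; case: pQ.
  move=> smallJ; apply: bigQ.
  apply: small_le (small_psum smallJ) => n.
  have eqC i : hilb xs (hcolon Q 1%N x) i = hilb xs Q i.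
    apply: hilb_eq => // [|z]; first exact: hideal_hcolon.
    apply/idP/idP => [|/(sub_hcolon xB hQ)//].
    rewrite inE => /andP[zB]; case/(pQ.2 _ _ _ _ xB zB) => //.
    by move=> xQ'; rewrite xQ' in xQ.
  elim: n => [|n IHn]; rewrite (hilb_hadd _ xB hQ) big_ord_recr /=.
    by rewrite leq_addl.
  by rewrite subSS subn0 eqC leq_add2r.
have [P [Pp Ps] JP] := IH J hJ bigJ.
exists (fun i => if i is i'.+1 then P i' else htotal Q); last exact: htotal_sub.
split=> [[|i]|[|i]] ij.
- exact: prime_htotal.
- exact: Pp.
- split.
    move=> z zQ; apply: JP; apply: htotal_sub zQ => n; exact: sub_hadd.
  exists x; last by rewrite (htotal_homog hQ xB).
  by apply: JP; rewrite (htotal_homog hJ xB); apply: mem_hadd.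
- exact: Ps.
Qed.

End HomogeneousIdeals.

(** * Boundedness of chains of primes *)

Fixpoint box (r N : nat) : seq (seq nat) :=
  if r is r'.+1 then [seq a :: b | a <- iota 0 N, b <- box r' N] else [:: [::]].

Lemma size_box r N : size (box r N) = (N ^ r)%N.
Proof. by elim: r => //= r IH; rewrite size_allpairs IH size_iota expnS. Qed.

Lemma mem_box r N al :
  (al \in box r N) = (size al == r) && all (fun a => a < N)%N al.
Proof.
elim: r al => [|r IH] [|a al] //=.
  by apply/allpairsP => -[[b be] [_ _]].
apply/allpairsP/idP => [[[b be] /= [bN beN [-> ->]]]|/and3P[sal aN alN]].
  by move: beN bN; rewrite IH mem_iota eqSS => /andP[-> ->] /= ->.
by exists (a, al); rewrite /= IH mem_iota /= add0n aN -eqSS sal.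
Qed.

Lemma box_uniq r N : uniq (box r N).
Proof.
elim: r => //= r IH; apply: allpairs_uniq => //; first exact: iota_uniq.
by move=> [a b] [c d] _ _ [-> ->].
Qed.

Section PrimeChains.
Variables (k : fieldType) (B : comAlgType k).

Lemma prime_idealD (P : {pred B}) x y : prime_ideal P ->
  x \in P -> y \in P -> x + y \in P.
Proof. by move=> [[_ _ PM] _] xP yP; rewrite -[x]mul1r PM. Qed.

Lemma prime_idealM (P : {pred B}) x y : prime_ideal P ->
  y \in P -> x * y \in P.
Proof. by move=> [[P0 _ PM] _] yP; rewrite -[_ * _]addr0 PM. Qed.

Lemma prime_idealDr (P : {pred B}) x y : prime_ideal P ->
  x + y \in P -> y \in P -> x \in P.
Proof.
move=> hP xyP yP; rewrite -(addrK y x) prime_idealD //.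
by rewrite -mulN1r prime_idealM.
Qed.

(** Modulo [Q] only the constant term [g 0] remains, so it is 0. The rest is divisible by [y], which
    cancels modulo [P], and the induction goes on. The condition on [g] stands for independence
    modulo [Q] of the later elements. *)
Lemma prime_ideal_horner (P Q : {pred B}) (y : B) (g : nat -> B) N :
  prime_ideal P -> prime_ideal Q -> {subset P <= Q} ->
  y \in Q -> y \notin P -> (forall a, g a \in Q -> g a = 0) ->
  \sum_(a < N) y ^+ a * g a \in P -> forall a, (a < N)%N -> g a = 0.
Proof.
move=> hP hQ PQ yQ yP; elim: N g => // N IH g gQ.
rewrite big_ord_recl expr0 mul1r.
have -> : \sum_(i < N) y ^+ lift ord0 i * g (lift ord0 i) =
          y * \sum_(i < N) y ^+ i * g i.+1.
  by rewrite mulr_sumr; apply: eq_bigr => i _; rewrite lift0 exprS mulrA.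
move=> sumP; have g0 : g 0%N = 0.
  apply/gQ/(prime_idealDr hQ (PQ _ sumP)).
  by rewrite mulrC; apply: prime_idealM.
move: sumP; rewrite g0 add0r => /hP.2; rewrite (negbTE yP) /= => sumP.
by case=> // a aN; apply: (IH (g \o S)) => // i; apply: gQ.
Qed.

(* The y_i are algebraically independent: factoring the least power of y_0 out
   of a relation leaves a relation modulo P_1 between the other y_i. *)
Lemma prime_chain_indep r (P : nat -> {pred B}) (y : nat -> B) N
    (c : seq nat -> k) :
  (forall i, (i <= r)%N -> prime_ideal (P i)) ->
  (forall i, (i < r)%N ->
     [/\ {subset P i <= P i.+1}, y i \in P i.+1 & y i \notin P i]) ->
  \sum_(al <- box r N) c al *: ev (mkseq y r) al \in P 0%N ->
  forall al, al \in box r N -> c al = 0.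
Proof.
elim: r P y c => [|r IH] P y c primeP chainP.
  rewrite big_seq1 /= => cP al; rewrite inE => /eqP ->; apply/eqP.
  have hP := primeP 0%N isT; have [[_ P1 _] _] := hP.
  apply: contraNT P1 => c0; rewrite -(scalerK c0 1).
  by rewrite -mulr_algl; apply: prime_idealM.
have -> : mkseq y r.+1 = y 0%N :: mkseq (y \o S) r.
  by rewrite /mkseq /= (iotaDl 1 0) -map_comp.
pose g a := \sum_(b <- box r N) c (a :: b) *: ev (mkseq (y \o S) r) b.
have cg a : g a \in P 1%N -> forall b, b \in box r N -> c (a :: b) = 0.
  apply: (IH (P \o S) (y \o S) (c \o cons a)) => i ir; first exact: primeP.
  exact: chainP.
rewrite /= big_allpairs_dep /=.
have -> : \sum_(a <- iota 0 N) \sum_(b <- box r N)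
    c (a :: b) *: (y 0%N ^+ a * ev (mkseq (y \o S) r) b) =
    \sum_(a < N) y 0%N ^+ a * g a.
  rewrite -(big_mkord xpredT (fun a => y 0%N ^+ a * g a)) /index_iota subn0.
  apply: eq_bigr => a _; rewrite mulr_sumr; apply: eq_bigr => b _.
  by rewrite scalerAr.
have [P01 yP1 yP0] := chainP 0%N isT.
move=> /(prime_ideal_horner (primeP 0%N isT) (primeP 1%N isT) P01 yP1 yP0) gN.
have gP1 a : g a \in P 1%N -> g a = 0.
  move=> /cg ca; rewrite /g big_seq big1 // => b bN; by rewrite ca ?scale0r.
move=> _ /allpairsP[[a b] [/= aN bN ->]]; apply: cg => //.
rewrite gN //; first by have [[]] := primeP 1%N isT.
by move: aN; rewrite mem_iota.
Qed.

(** * The degree filtration and the comparison of [krull_dim] with Hilbert functions *)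

Variable B_ : nat -> {pred B}.
Hypothesis gB : standard_graded predT B_.
Variable xs : seq B.
Hypothesis xsB : {subset xs <= B_ 1%N}.
Hypothesis xs_gen :
  forall S : {pred B}, subalg_closed S -> {subset xs <= S} ->
    {subset (predT : {pred B}) <= S}.

Let sB n : submod_closed (B_ n). Proof. exact: sg_submod gB n. Qed.

Definition degree_le (d : nat) (z : B) : Prop :=
  exists p, [/\ homog B_ p, (size p <= d.+1)%N & p.[1] = z].

Lemma degree_leW d e z : (d <= e)%N -> degree_le d z -> degree_le e z.
Proof.
by move=> de [p [hp sp pz]]; exists p; split=> //; apply: leq_trans sp _.
Qed.

Lemma degree_leM d e y z :
  degree_le d y -> degree_le e z -> degree_le (d + e) (y * z).
Proof.
move=> [p [hp sp <-]] [q [hq sq <-]]; exists (p * q); split.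
- exact: homogM sB (sg_mul gB) hp hq.
- by apply: leq_trans (size_polyMleq _ _) _; lia.
- by rewrite hornerM.
Qed.

Lemma degree_le1 d : degree_le d 1.
Proof.
exists 1; split; [|by rewrite size_poly1|by rewrite hornerC].
move=> n; rewrite coef1; case: eqP => [->|_]; first exact: gr1 gB.
by case: (sB n).
Qed.

Lemma degree_le_ev d (ys : seq B) al : (forall y, y \in ys -> degree_le d y) ->
  degree_le (d * sumn al) (ev ys al).
Proof.
elim: ys al => [|y ys IH] [|a al] hys; try exact: degree_le1.
rewrite /= mulnDr; apply: degree_leM; last first.
  by apply: IH => z zys; apply: hys; rewrite inE zys orbT.
elim: a => [|a IHa]; first exact: degree_le1.
rewrite mulnS exprS; apply: degree_leM => //.
exact/hys/mem_head.
Qed.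

Lemma leq_sumn al a : a \in al -> (a <= sumn al)%N.
Proof.
elim: al => //= b al IH; rewrite inE => /orP[/eqP ->|/IH]; lia.
Qed.

Lemma degree_le_span d z : degree_le d z ->
  z \in addspan (pred1 0) [seq ev xs al | al <- box (size xs) d.+1].
Proof.
have s0 := submod_pred1_0 B.
move=> [p [hp sp <-]]; rewrite horner_coef.
apply: submod_sum => [|i _]; first exact: submod_addspan.
rewrite expr1n mulr1; have := hp i; rewrite (gr_span gB xsB xs_gen).
apply: addspan_sub => // _ /mapP[al + ->]; rewrite mem_mons => /andP[sal nal].
apply: map_f; rewrite mem_box sal; apply/allP => a /leq_sumn.
by rewrite (eqP nal) => ai; apply: leq_ltn_trans ai (leq_trans _ sp).
Qed.

(** The [N ^ r] monomials in the [y i] with exponents below [N] are independent, and they lie in the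
    span of the monomials in [xs] with exponents at most [a * N]. *)
Lemma prime_chain_count r (P : nat -> {pred B}) : prime_chain r P ->
  exists a, forall N, (N ^ r <= (a * N).+1 ^ size xs)%N.
Proof.
move=> [primeP chainP].
have /choice[y hy] : forall i, exists y, (i < r)%N ->
    y \in P i.+1 /\ y \notin P i.
  move=> i; have [ir|] := boolP (i < r)%N; last by exists 0.
  by have [_ [y y1 y0]] := chainP i ir; exists y.
have /choice[d hd] : forall i, exists d, degree_le d (y i).
  move=> i.
  have [p hp <-] := homog_decomp gB (isT : y i \in (predT : {pred B})).
  by exists (size p); exists p; split=> //; apply: leqnSn.
(* [D] bounds the degrees of all [y i], so a monomial in them with exponents below [N] has degree at
   most [D * r * N]. *)
pose D := (\max_(i < r) d i)%N.
have hD z : z \in mkseq y r -> degree_le D z.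
  move=> /mapP[i]; rewrite mem_iota /= add0n => ir ->.
  by apply: degree_leW (hd i); apply: (leq_bigmax (Ordinal ir)).
exists (D * r)%N => N.
have s0 := submod_pred1_0 B.
pose v (i : 'I_(N ^ r)) := ev (mkseq y r) (nth [::] (box r N) i).
rewrite -[leqRHS]size_box -(size_map (ev xs)).
apply: (indep_le_size s0 (v := v)) => [i|c].
  apply/degree_le_span/(degree_leW _ (degree_le_ev _ hD)).
  have : nth [::] (box r N) i \in box r N by rewrite mem_nth ?size_box.
  rewrite mem_box -mulnA leq_mul2l => /andP[/eqP sal lt]; apply/orP; right.
  move: (nth _ _ _) sal lt => al <-; elim: al => //= a al IH /andP[aN /IH].
  by rewrite mulSn; apply: leq_add; apply: ltnW.
rewrite inE => /eqP c0 i.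
(* Coefficients are carried over from indices to exponent vectors, as [prime_chain_indep] expects;
   the default 0 is not reached on [box r N]. *)
pose c' al := oapp c 0 (insub (index al (box r N))).
have c'E (j : 'I_(N ^ r)) : c' (nth [::] (box r N) j) = c j.
  by rewrite /c' index_uniq ?size_box ?box_uniq // valK.
rewrite -c'E; apply: (@prime_chain_indep r P y N c') => //.
- by move=> j jr; have [sj _] := chainP j jr; have [] := hy j jr.
- rewrite (big_nth [::]) size_box big_mkord.
  have -> : \sum_(j < N ^ r) c' (nth [::] (box r N) j) *:
     ev (mkseq y r) (nth [::] (box r N) j) = \sum_j c j *: v j.
    by apply: eq_bigr => j _; rewrite c'E.
  by rewrite c0; have [[]] := primeP 0%N isT.
- by rewrite mem_nth ?size_box.
Qed.

Lemma prime_chain_bound r (P : nat -> {pred B}) : prime_chain r P ->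
  (r <= size xs)%N.
Proof.
move=> [primeP chainP]; rewrite leqNgt; apply/negP => lt.
have [|a ha] := @prime_chain_count (size xs).+1 P.
  split=> i ir; first by apply: primeP; apply: leq_trans ir lt.
  by apply: chainP; apply: leq_trans ir lt.
(* With [m = size xs], the count for a chain cut at length [m + 1] gives
   [N ^ (m + 1) <= ((a + 1) * N) ^ m], which fails once [N > (a + 1) ^ m]. *)
pose N := (a.+1 ^ size xs).+1.
have := ha N; apply/negP; rewrite -ltnNge expnS.
apply: (@leq_ltn_trans ((a.+1 * N) ^ size xs)).
  by apply: leq_expl; rewrite mulSn -addn1 addnC leq_add2r.
by rewrite expnMn ltn_pmul2r ?expn_gt0.
Qed.

(** Since lengths of chains are bounded by [size xs], a maximal one exists and [xget] does not
    return its default. *)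
Lemma krull_dim_ge r (P : nat -> {pred B}) : prime_chain r P ->
  (r <= krull_dim B)%N.
Proof.
move=> hP; pose D d := `[< exists P : nat -> {pred B}, prime_chain d P >].
have exD : exists d, D d by exists r; apply/asboolP; exists P.
have ubD d : D d -> (d <= size xs)%N.
  by move=> /asboolP[Q]; apply: prime_chain_bound.
have [d Dd maxd] := ex_maxnP exD ubD.
have [|_] := @xgetPex nat 0%N
  [set d | (exists P : nat -> {pred B}, prime_chain d P) /\
           (forall e (P : nat -> {pred B}), prime_chain e P -> (e <= d)%N)].
  exists d; split; first exact/asboolP.
  by move=> e Q hQ; apply: maxd; apply/asboolP; exists Q.
by move=> /(_ r P hP).
Qed.

Lemma small_hilb0 : small (krull_dim B).-1.+1 (hilb xs (fun=> pred1 0)).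
Proof.
apply: contrapT => hbig.
have [P hP _] := prime_chain_big gB xsB xs_gen (j := (krull_dim B).-1.+2)
  (hideal0 gB) hbig.
(* The chain has length [(krull_dim B).-1.+2], which exceeds [krull_dim B] even when the latter is
   0. *)
by have := krull_dim_ge hP; case: (krull_dim B) => //= d; rewrite ltnn.
Qed.

End PrimeChains.

(** * Limits *)

Section Limit.
Variable R : realType.
Implicit Types (p : {poly R}) (f g : nat -> nat).

Lemma evpolyB f g : (forall n, g n <= f n)%N ->
  evpoly R f -> evpoly R g -> evpoly R (fun n => f n - g n)%N.
Proof.
move=> gf [p [N hp]] [q [M hq]]; exists (p - q), (maxn N M) => n.
by rewrite geq_max => /andP[Nn Mn]; rewrite natrB // hornerD hornerN hp // hq.
Qed.

Lemma cvg_horner p (u : nat -> R) (l : R) :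
  u n @[n --> \oo] --> l -> p.[u n] @[n --> \oo] --> p.[l].
Proof.
move=> ul; elim/poly_ind: p => [|p c IH].
  under eq_fun do rewrite horner0.
  by rewrite horner0; apply: cvg_cst.
under eq_fun do rewrite hornerD hornerMX hornerC.
rewrite hornerD hornerMX hornerC.
by apply: cvgD; [apply: cvgM|apply: cvg_cst].
Qed.

(* With r the reversed polynomial X^d p(1/X), p(x) / x^d = r(1/x) tends to
   r(0). *)
Lemma cvg_horner_div p d : (size p <= d.+1)%N ->
  p.[n.+1%:R] / n.+1%:R ^+ d @[n --> \oo] --> p`_d.
Proof.
move=> sp; pose r := \poly_(i < d.+1) p`_(d - i).
have r0 : r.[0] = p`_d by rewrite horner_coef0 coef_poly subn0.
have rE n : p.[n.+1%:R] / n.+1%:R ^+ d = r.[harmonic n].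
  rewrite horner_poly (horner_coef_wide _ sp) mulr_suml.
  rewrite (reindex_inj rev_ord_inj) /=; apply: eq_bigr => i _.
  rewrite subSS -mulrA; congr (_ * _).
  rewrite exprVn -[X in _ / _ ^+ X](subnK (ltn_ord i : (i <= d)%N)) exprD.
  by rewrite invfM mulrA mulfV ?mul1r // expf_neq0 // pnatr_eq0.
under eq_fun do rewrite rE.
by rewrite -r0; apply: cvg_horner; apply: cvg_harmonic.
Qed.

(** If [p] has degree at most [e], the limit is its coefficient of degree [e]. A larger degree
    [d + 1] is impossible: dividing by [n ^ (d + 1)] gives the leading coefficient as limit, while
    the growth bound forces this limit to be 0. *)
Lemma evpoly_cvg f e : evpoly R f -> small e.+1 f ->
  exists l : R, (f n)%:R / n%:R ^+ e @[n --> \oo] --> l.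
Proof.
move=> [p [N hp]] [c hc].
have cvgp d : (size p <= d.+1)%N ->
    (f n)%:R / n%:R ^+ d @[n --> \oo] --> p`_d.
  move=> sp; rewrite -cvg_shiftS; apply: cvg_trans (cvg_horner_div sp).
  apply: near_eq_cvg; near=> n; rewrite /= hp //.
  by apply: leqW; near: n; apply: nbhs_infty_ge.
have [|lt] := leqP (size p) e.+1; first by move=> /cvgp; exists (p`_e).
have [d sp ed] : exists2 d, size p = d.+2 & (e <= d)%N.
  by case: (size p) lt => [|[|d]] // ed; exists d.
suff : lead_coef p = 0 by move/eqP; rewrite lead_coef_eq0 -size_poly_eq0 sp.
have cvgpd : (f n)%:R / n%:R ^+ d.+1 @[n --> \oo] --> p`_d.+1.
  by apply: cvgp; rewrite sp.
rewrite lead_coefE sp -(cvg_lim (@Rhausdorff R) cvgpd).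
apply: (cvg_lim (@Rhausdorff R)); rewrite -cvg_shiftS /=.
apply: (squeeze_cvgr (f := fun=> 0)
  (h := fun n => (c * 2 ^ e)%:R * harmonic n)); last first.
- rewrite -[X in _ --> X](mulr0 (c * 2 ^ e)%:R).
  by apply: cvgM; [apply: cvg_cst|apply: cvg_harmonic].
- exact: cvg_cst.
near=> n; rewrite divr_ge0 ?exprn_ge0 ?ler0n //=.
rewrite ler_pdivrMr ?exprn_gt0 ?ltr0n // -mulrA exprS.
rewrite /harmonic mulKf ?pnatr_eq0 // -natrX -natrM ler_nat.
apply: leq_trans (hc _) _.
rewrite -mulnA leq_mul2l; apply/orP; right.
(* The sequence is shifted by one to avoid dividing by 0, so the bound reads [n.+2 ^ e]; comparing
   [n.+2] with [2 * n.+1] accounts for the constant [2 ^ e]. *)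
apply: (@leq_trans ((2 * n.+1) ^ e)); first by apply: leq_expl; lia.
by rewrite expnMn leq_mul2l leq_pexp2l ?orbT.
Unshelve. all: by end_near. Qed.

End Limit.

Theorem proposition2 (R : realType) (k : fieldType) (B : comAlgType k)
    (B_ : nat -> {pred B}) (A : {pred B}) (A_ : nat -> {pred B})
    (hB : standard_graded predT B_) (Bred : reduced_ring B)
    (hA : standard_graded A A_) (hAB : forall n, {subset A_ n <= B_ n}) :
  exists l : R,
    normalized_length R A_ B_ n @[n --> \oo] --> l%:E /\
    epsilon_mult R A_ B_ = l%:E.
Proof.
suff [l hl] : exists l : R, normalized_length R A_ B_ n @[n --> \oo] --> l%:E.
  by exists l; split=> //; rewrite /epsilon_mult (cvg_limn_einf_sup hl).2.
have [xs [xsB xs_gen]] := sg_gen hB; have [ys [ysA ys_gen]] := sg_gen hA.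
(* The Hilbert functions of [B] and [A], each counted by monomials in its own generators. *)
pose f := hilb xs (fun=> pred1 0); pose g := hilb ys (fun=> pred1 (0 : B)).
have sA n : submod_closed (A_ n) := sg_submod hA n.
have sB n : submod_closed (B_ n) := sg_submod hB n.
have s0 := submod_pred1_0 B.
have hf n : qdim (B_ n) (pred1 0) (f n).
  exact: (qdim_hilb hB xsB xs_gen n (hideal0 hB)).
have hg n : qdim (A_ n) (pred1 0) (g n).
  exact: (qdim_hilb hA ysA ys_gen n (hideal0 hA)).
have gf n : (g n <= f n)%N.
  exact: (qdim_le s0 (@hAB n) (fun x (h : x \in pred1 0) => h)).
(* Additivity of dimension along [0 <= A_ n <= B_ n]; the greedy count [d] first shows that the
   quotient is finite-dimensional. *)
have hfg n : qdim (B_ n) (A_ n) (f n - g n).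
  pose d := nindep (A_ n) [seq ev xs al | al <- mons (size xs) n].
  have hd : qdim (B_ n) (A_ n) d.
    apply: qdim_ext (qdim_addspan _ (sA n)) => // x; apply/idP/idP.
      apply: addspan_min; [exact: sB|exact: hAB|move=> _ /mapP[al + ->]].
      by rewrite mem_mons => /andP[/eqP sal /eqP <-]; apply: (ev_gr hB).
    rewrite (gr_span hB xsB xs_gen); apply: addspan_sub => // y.
    by rewrite inE => /eqP ->; case: (sA n).
  suff -> : (f n - g n)%N = d by [].
  have -> : f n = (g n + d)%N; last by rewrite addKn.
  apply: (qdim_uniq s0 (hf n)).
  apply: (@qdim_add _ _ (B_ n) (A_ n)) => // y.
  by rewrite inE => /eqP ->; case: (sA n).
have pfg : evpoly R (fun n => f n - g n)%N.
  apply: evpolyB => //.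
    exact: (evpoly_hilb hB xsB R (hideal0 hB)).
  exact: (evpoly_hilb hA ysA R (hideal0 hA)).
(* The difference is bounded by the Hilbert function of [B], so the dimension of [B] alone controls
   its growth. *)
have sfg : small (krull_dim B).-1.+1 (fun n => f n - g n)%N.
  by apply: small_le (small_hilb0 hB xsB xs_gen) => n; apply: leq_subr.
have [l hl] := evpoly_cvg pfg sfg.
set e := (krull_dim B).-1 in hl.
exists (e`!%:R * l).
have -> : normalized_length R A_ B_ =
    EFin \o (fun n => e`!%:R * ((f n - g n)%N%:R / n%:R ^+ e)).
  apply/funext => n; rewrite /normalized_length (quot_dimE R (sA n) (hfg n)).
  by rewrite -EFinM /= mulrAC mulrA.
apply: cvg_EFin; first exact: nearW.
by apply: cvgM; [apply: cvg_cst|apply: hl].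
Qed.
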